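(* Let $p,q>0$ be fixed, and for $n\in\mathbb N$ let $Y$ be distributed as $\sqrt{\mathrm{Beta}(np,nq)}$. Then, as $n\to\infty$, $$\frac{2(p+q)}{\sqrt q}\sqrt n\left(Y-\sqrt{\frac p{p+q}}\right)\Rightarrow N(0,1).$$ Moreover, there is a constant $K_{p,q}>0$, independent of $n$ and continuous in $p,q$ positive, such that, provided $n>\max\{\frac1p,\frac1q\}$, it is possible to couple $Y$ to a standard normal $X$ so that $$\mathrm{Var}\left(Y-\frac{\sqrt q}{2(p+q)\sqrt n}X\right)\le\frac{K_{p,q}}{n^2}.$$
   Context: $\mathrm{Beta}(r,s)$ is the Beta distribution on $[0,1]$ with density proportional to $x^{r-1}(1-x)^{s-1}$; $Y\sim\sqrt{\mathrm{Beta}(r,s)}$ means $Y\ge0$ and $Y^2\sim\mathrm{Beta}(r,s)$. $\Rightarrow$ denotes convergence in distribution. Coupling $Y$ to $X$ means constructing both on a common probability space with the given marginal laws. *)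

(* Defs.v *)
From HB Require Import structures.
From mathcomp Require Import all_boot all_order all_algebra.
From mathcomp Require Import all_classical all_reals all_analysis.
Set Implicit Arguments.
Unset Strict Implicit.
Unset Printing Implicit Defensive.
Import Order.TTheory GRing.Theory Num.Theory.
Import numFieldNormedType.Exports.
Local Open Scope classical_set_scope.
Local Open Scope ring_scope.

(* [beta_prob] of MathComp-Analysis only has natural number parameters;
   here the parameters are real. *)
Definition beta_weight {R : realType} (r s x : R) : R :=
  x `^ (r - 1) * (1 - x) `^ (s - 1).

(* The integral is finite and positive when r and s are positive. *)
Definition beta_integral {R : realType} (r s : R) : R :=
  Rintegral lebesgue_measure `[0, 1] (beta_weight r s).

Definition beta_law {R : realType} (r s : R) (A : set R) : \bar R :=
  (\int[lebesgue_measure]_(x in A `&` `[0%R, 1%R])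
     (beta_weight r s x / beta_integral r s)%:E)%E.

Definition has_law {d} {T : measurableType d} {R : realType}
    (P : probability T R) (X : T -> R) (law : set R -> \bar R) : Prop :=
  forall A : set R, measurable A -> pushforward P X A = law A.

Definition has_sqrt_beta_law {d} {T : measurableType d} {R : realType}
    (P : probability T R) (Y : T -> R) (r s : R) : Prop :=
  {ae P, forall t, 0 <= Y t} /\ has_law P (fun t => Y t ^+ 2) (beta_law r s).

(* For measurable Z n, the pushforward of P n at `]-oo, x] is the cdf of Z n. *)
Definition cvg_in_distribution {R : realType} {d : nat -> measure_display}
    {T : forall n, measurableType (d n)} (P : forall n, probability (T n) R)
    (Z : forall n, T n -> R) (mu : probability (measurableTypeR R) R) : Prop :=
  forall x : R,
    {for x, continuous (fun y : R => mu `]-oo, y]%classic)} ->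
    (fun n : nat => pushforward (P n) (Z n) `]-oo, x]%classic) @ \oo
      --> mu `]-oo, x]%classic.

(* Main.v *)
Require Import Defs.
From HB Require Import structures.
From mathcomp Require Import all_boot all_order all_algebra.
From mathcomp Require Import all_classical all_reals all_analysis.
From mathcomp Require Import measurable_realfun ring lra.
Set Implicit Arguments.
Unset Strict Implicit.
Unset Printing Implicit Defensive.
Import Order.TTheory GRing.Theory Num.Theory.
Import numFieldNormedType.Exports.
Local Open Scope classical_set_scope.
Local Open Scope ring_scope.

(** The proof is a quantitative normal approximation by optimal transport in
    dimension one, the increasing rearrangement being the optimal map.

    Write [a = n p], [b = n q], [N = a + b], [m ^ 2 = a / N] and
    [c = sqrt b / (2 N)]. On the beta probability space, whose density is [f]
    and whose distribution function is [F], take [Y = sqrt u], and take for [X]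
    the increasing map [T u] with [gauss_cdf (T u) = F u]; it carries the beta
    law to the standard normal law. Both claims follow from the single estimate
    that [Y - m - c X] has second moment [O (1 / N ^ 2)].

    The estimate is a transport inequality, [transport_score_estimate]: the second
    moment of [Y - m - c X] is at most that of [S], where [S] is [c ^ 2] times the
    difference between the score of the law of [Y] and that of the normal law of
    mean [m] and variance [c ^ 2]. (It is what one obtains from the Gaussian
    inequalities of Talagrand and of Gross, but in dimension one it is a mere
    integration by parts.) With [D = c X - (Y - m)], multiply [D] by
    [2 c ^ 2 sqrt u f - c gauss_pdf T], that is by [c] times the difference of
    the densities of [(Y - m) / c] and of [X]. The derivative of this product is
    a nonnegative term plus [f (D ^ 2 - D S)]; the nonnegative term compares the
    slopes of [c T] and of [sqrt u] and is of the form [x + 1 / x - 2]. Boundary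
    terms vanish because [T f] does ([norm_transport_density]), so the mean of
    [D ^ 2 - D S] is at most 0.

    It remains to bound the second moment of [S]. The law of [Y] has negative
    log-density [N] times a fixed function with minimum at [m] and second
    derivative [1 / (N c ^ 2)] there, plus a lower order term; the difference of
    scores is therefore quadratic in [Y - m] up to the factor
    [1 / (Y (1 - Y ^ 2))] ([score_defect_le]). Squared, this factor only shifts
    the parameters of the beta law, and the fourth central moment of a beta law
    is [O (1 / N ^ 2)] by the usual recursion ([beta_int_defect_le]). This needs
    [a] and [b] to be bounded below by some constant; the finitely many other
    values of [n] contribute a bounded amount to the constant.

    For the convergence in distribution, the distribution function of [Y n] on
    any probability space is that of the coupled variable, and Chebyshev's
    inequality bounds its distance from the normal one. *)

(** * Integration by parts on the unit interval *)

(** Every integral identity below is read off from a derivative. With the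
    derivative split into two nonnegative parts the identity makes sense in the
    extended reals, so integrability need not be known in advance: on compact
    subintervals this is the fundamental theorem of calculus, and both sides
    converge monotonically. *)
Lemma integral_eq_of_derive (R : realType) (G A B : R -> R) :
  (forall x : R, 0 < x < 1 -> is_derive x 1 G (A x - B x)) ->
  (forall x, 0 < x < 1 -> {for x, continuous A}) ->
  (forall x, 0 < x < 1 -> {for x, continuous B}) ->
  (forall x, 0 < x < 1 -> 0 <= A x) -> (forall x, 0 < x < 1 -> 0 <= B x) ->
  G x @[x --> 0^'+] --> (0 : R) -> G x @[x --> 1^'-] --> (0 : R) ->
  (\int[lebesgue_measure]_(x in `]0%R, 1%R[) (A x)%:E =
   \int[lebesgue_measure]_(x in `]0%R, 1%R[) (B x)%:E)%E.
Proof.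
move=> dG cA cB A0 B0 G0 G1.
pose e (i : nat) : R := (i.+3)%:R^-1.
have e_gt0 i : 0 < e i by rewrite invr_gt0 ltr0n.
have e_lt i : e i < 1 / 2 by rewrite /e div1r ltf_pV2 ?posrE ?ltr_nat//.
have e_cvg : e i @[i --> \oo] --> (0 : R).
  have := @cvg_harmonic R; rewrite -(cvg_shiftn 2)/=.
  by apply: cvg_trans; apply: near_eq_cvg; near=> n; rewrite /e /= addn2.
pose K i : set R := `[e i, 1 - e i]%classic.
have KS i x : K i x -> 0 < x < 1.
  rewrite /K /= !in_itv/= => /andP[h1 h2].
  by have := e_gt0 i; move=> ?; apply/andP; split; lra.
have KU : \bigcup_i K i = `]0, 1[%classic.
  apply/seteqP; split => [x [i _ /KS//]|x /=].
  rewrite in_itv/= => /andP[x0 x1].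
  have m0 : 0 < Num.min x (1 - x) by rewrite lt_min x0 subr_gt0.
  have [i] := ltr_add_invr m0; rewrite add0r lt_min => /andP[h1 h2].
  have ei : e i < i.+1%:R^-1 by rewrite /e ltf_pV2 ?posrE ?ltr_nat//.
  move: ei h1 h2; set r := i.+1%:R^-1 => ei h1 h2.
  by exists i => //; rewrite /K/= in_itv/=; apply/andP; split; lra.
have nK : nondecreasing_seq K.
  apply/nondecreasing_seqP => i; apply/subsetPset => x; rewrite /K /= !in_itv/=.
  have : e i.+1 < e i by rewrite /e ltf_pV2 ?posrE ?ltr_nat//.
  by move=> h /andP[h1 h2]; apply/andP; split; lra.
have mK i : @measurable _ (measurableTypeR R) (K i) by exact: measurable_itv.
have cK (f : R -> R) i : (forall x, 0 < x < 1 -> {for x, continuous f}) ->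
    {within K i, continuous f}.
  move=> cf; apply: continuous_in_subspaceT => x; rewrite inE => /KS xi.
  exact: cf.
have iK (f : R -> R) i : (forall x, 0 < x < 1 -> {for x, continuous f}) ->
    lebesgue_measure.-integrable (K i) (EFin \o f).
  move=> cf; apply: continuous_compact_integrable; last exact: cK.
  exact: segment_compact.
have lim (f : R -> R) : (forall x, 0 < x < 1 -> {for x, continuous f}) ->
    (forall x, 0 < x < 1 -> 0 <= f x) ->
    (\int[lebesgue_measure]_(x in K i) (f x)%:E @[i --> \oo] -->
      \int[lebesgue_measure]_(x in `]0%R, 1%R[) (f x)%:E)%E.
  move=> cf f0; rewrite -KU; apply: ge0_nondecreasing_set_cvg_integral => //.
  - by move=> i; exact: measurable_int (iK f i cf).
  - by move=> i x /KS xi; rewrite lee_fin; apply: f0.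
have cG x : 0 < x < 1 -> {for x, continuous G}.
  move=> /dG[dGx _]; apply: differentiable_continuous.
  exact/derivable1_diffP.
have E i : ((\int[lebesgue_measure]_(x in K i) (A x)%:E) =
    (G (1 - e i) - G (e i))%:E + \int[lebesgue_measure]_(x in K i) (B x)%:E)%E.
  have [e0 eh] := (e_gt0 i, e_lt i).
  have fB := integrable_fin_num (mK i) (iK B i cB).
  rewrite EFinB -(@continuous_FTC2 _ (A \- B)%R G).
  - under [in RHS]eq_integral do rewrite /= EFinB.
    by rewrite integralB_EFin//; [rewrite subeK|exact: iK|exact: iK].
  - lra.
  - by apply: cK => x xi; apply: cvgB; [exact: cA|exact: cB].
  - split.
    + by move=> x /subset_itv_oo_cc/KS /dG [].
    + by apply/cvg_at_right_filter/cG; apply/andP; split; lra.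
    + by apply/cvg_at_left_filter/cG; apply/andP; split; lra.
  - by move=> x /subset_itv_oo_cc/KS /dG [_]; rewrite derive1E.
have := lim _ cA A0; under eq_fun do rewrite E; move=> lA.
have lB : (((G (1 - e i) - G (e i))%:E +
    \int[lebesgue_measure]_(x in K i) (B x)%:E) @[i --> \oo] -->
   0%:E + \int[lebesgue_measure]_(x in `]0%R, 1%R[) (B x)%:E)%E.
  apply: cvgeD => //; last exact: lim.
  apply: cvg_EFin; first by near=> i.
  rewrite -[X in _ --> X](subr0 (0:R)).
  apply: cvgB.
    move/cvg_at_leftP : G1; apply; split; first by move=> n; have := e_gt0 n; lra.
    by rewrite -[X in _ --> X]subr0; apply: cvgB => //; exact: cvg_cst.
  by move/cvg_at_rightP : G0; apply.
by rewrite add0e in lB; apply: cvg_unique lA lB.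
Unshelve. all: by end_near. Qed.

(** * The beta weight *)

Lemma powRB1 (R : realType) (x r : R) : 0 < x -> x `^ (r - 1) = x `^ r / x.
Proof.
move=> x0; rewrite powRB; last by rewrite (gt_eqF x0) implybT.
by rewrite powRr1// ltW.
Qed.

Section beta_weight_theory.
Variable R : realType.
Implicit Types r s x : R.

Lemma beta_weight_gt0 r s x : 0 < x < 1 -> 0 < beta_weight r s x.
Proof. by case/andP=> x0 x1; rewrite mulr_gt0// powR_gt0// subr_gt0. Qed.

Lemma beta_weight_le1 r s x : 1 <= r -> 1 <= s -> 0 < x < 1 ->
  beta_weight r s x <= 1.
Proof.
move=> r1 s1 /andP[x0 x1]; have y0 : 0 < 1 - x by rewrite subr_gt0.
have le1 (y t : R) : 0 < y <= 1 -> 1 <= t -> y `^ (t - 1) <= 1.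
  by move=> y01 t1; rewrite -[leRHS](powRr0 y) ger_powR// subr_ge0.
by rewrite /beta_weight -[leRHS](mulr1 1) ler_pM ?powR_ge0 ?le1//; lra.
Qed.

Lemma beta_weightSl r s x : 0 < x < 1 ->
  beta_weight (r + 1) s x = x * beta_weight r s x.
Proof.
move=> /andP[x0 x1]; rewrite /beta_weight (powRB1 r x0) addrK.
by field; rewrite gt_eqF.
Qed.

Lemma beta_weightSr r s x : 0 < x < 1 ->
  beta_weight r (s + 1) x = (1 - x) * beta_weight r s x.
Proof.
move=> /andP[x0 x1]; have y0 : 0 < 1 - x by rewrite subr_gt0.
rewrite /beta_weight (powRB1 s y0) addrK.
by field; rewrite gt_eqF.
Qed.

Lemma is_derive_beta_weight r s x : 0 < x < 1 ->
  is_derive x 1 (beta_weight r s)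
    (beta_weight r s x * ((r - 1) / x - (s - 1) / (1 - x))).
Proof.
move=> /andP[x0 x1]; have y0 : 0 < 1 - x by rewrite subr_gt0.
have d1 : is_derive x 1 (fun x => x `^ (r - 1)) ((r - 1) * x `^ (r - 1 - 1)).
  exact: is_derive1_powR.
have d2 : is_derive x 1 ((fun y => y `^ (s - 1)) \o (fun x => 1 - x))
    ((s - 1) * (1 - x) `^ (s - 1 - 1) * (0 - 1)).
  by apply: is_derive1_comp; exact: is_derive1_powR.
have := is_deriveM d1 d2; rewrite /= => d.
apply: is_derive_eq; rewrite /GRing.scale/= /beta_weight !(powRB1 (_ - 1))//.
by field; rewrite !gt_eqF.
Qed.

Lemma continuous_beta_weight r s x : 0 < x < 1 ->
  {for x, continuous (beta_weight r s)}.
Proof.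
move=> /(is_derive_beta_weight r s)[d _].
exact/differentiable_continuous/derivable1_diffP.
Qed.

(** With exponents above 1 the weight vanishes at both end points, which is
    how boundary terms are discarded. *)
Lemma cvg0_beta_weight_bound r s C (G : R -> R) : 1 < r -> 1 < s ->
  (forall x, 0 < x < 1 -> `|G x| <= C * beta_weight r s x) ->
  G x @[x --> 0^'+] --> (0 : R) /\ G x @[x --> 1^'-] --> (0 : R).
Proof.
move=> r1 s1 GC.
have pow0 (t : R) : 1 < t -> `|C| * x `^ (t - 1) @[x --> 0^'+] --> (0 : R).
  move=> t1; rewrite -[X in _ --> X](mulr0 `|C|); apply: cvgM; first exact: cvg_cst.
  by apply: powR_cvg0; rewrite subr_gt0.
have le1 (y t : R) : 0 < y <= 1 -> 1 < t -> y `^ (t - 1) <= 1.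
  by move=> y01 t1; rewrite -[leRHS](powRr0 y) ger_powR// subr_ge0 ltW.
have Gl x : 0 < x < 1 -> `|G x| <= `|C| * x `^ (r - 1).
  move=> x01; rewrite (le_trans (GC _ x01))//.
  rewrite (le_trans (ler_norm _))// normrM ler_wpM2l//.
  rewrite ger0_norm ?(ltW (beta_weight_gt0 _ _ x01))// /beta_weight.
  by rewrite ler_piMr ?powR_ge0// le1//; lra.
have Gr x : 0 < x < 1 -> `|G x| <= `|C| * (1 - x) `^ (s - 1).
  move=> x01; rewrite (le_trans (GC _ x01))//.
  rewrite (le_trans (ler_norm _))// normrM ler_wpM2l//.
  rewrite ger0_norm ?(ltW (beta_weight_gt0 _ _ x01))// /beta_weight.
  by rewrite ler_piMl ?powR_ge0// le1//; lra.
split; apply: norm_cvg0.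
- apply: (@squeeze_cvgr _ _ _ _ (fun=> 0) (fun x => `|C| * x `^ (r - 1))).
  + near=> x; rewrite normr_ge0/= Gl//; apply/andP; split.
      by near: x; exact: nbhs_right_gt.
    by near: x; exact: nbhs_right_lt.
  + exact: cvg_cst.
  + exact: pow0.
- apply: (@squeeze_cvgr _ _ _ _ (fun=> 0) (fun x => `|C| * (1 - x) `^ (s - 1))).
  + near=> x; rewrite normr_ge0/= Gr//; apply/andP; split.
      by near: x; exact: nbhs_left_gt.
    by near: x; exact: nbhs_left_lt.
  + exact: cvg_cst.
  + apply/cvg_at_leftP => u [u1 ucvg].
    have /cvg_at_rightP/(_ (fun n => 1 - u n)) := pow0 _ s1; apply; split.
      by move=> n; rewrite subr_gt0.
    by rewrite -(subrr (1:R)); apply: cvgB => //; exact: cvg_cst.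
Unshelve. all: by end_near. Qed.

End beta_weight_theory.

(** * Integrals against the beta weight *)

Lemma measurable_fun_oo (R : realType) (f : R -> R) :
  (forall x, 0 < x < 1 -> {for x, continuous f}) ->
  measurable_fun (`]0, 1[ : set (measurableTypeR R)) f.
Proof.
move=> cf; apply: open_continuous_measurable_fun; first exact: interval_open.
by move=> x; rewrite inE/= in_itv/=; exact: cf.
Qed.

Section beta_moments.
Variable R : realType.
Implicit Types (r s x m : R) (g h : R -> R).
Local Notation mu := (@lebesgue_measure R).

Definition beta_int r s g : \bar R :=
  (\int[mu]_(x in `]0%R, 1%R[) (g x * beta_weight r s x)%:E)%E.

Lemma continuous_mul_beta_weight r s g :
  (forall x, {for x, continuous g}) ->
  forall x, 0 < x < 1 -> {for x, continuous (fun x => g x * beta_weight r s x)}.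
Proof.
by move=> cg x x01; apply: cvgM; [exact: cg|exact: continuous_beta_weight].
Qed.

Lemma beta_int_ge0 r s g : (forall x, 0 < x < 1 -> 0 <= g x) ->
  (0 <= beta_int r s g)%E.
Proof.
move=> g0; apply: integral_ge0 => x; rewrite /= in_itv/= => x01.
by rewrite lee_fin mulr_ge0 ?g0// ltW// beta_weight_gt0.
Qed.

Lemma le_beta_int r s g h :
  (forall x, {for x, continuous g}) -> (forall x, {for x, continuous h}) ->
  (forall x, 0 < x < 1 -> 0 <= g x <= h x) ->
  (beta_int r s g <= beta_int r s h)%E.
Proof.
move=> cg ch gh; apply: ge0_le_integral => //.
- move=> x; rewrite /= in_itv/= => x01; have /andP[g0 _] := gh x x01.
  by rewrite lee_fin mulr_ge0// ltW// beta_weight_gt0.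
- apply/measurable_EFinP; apply: measurable_fun_oo; exact: continuous_mul_beta_weight.
- apply/measurable_EFinP; apply: measurable_fun_oo; exact: continuous_mul_beta_weight.
- move=> x; rewrite /= in_itv/= => x01; have /andP[_ h0] := gh x x01.
  by rewrite lee_fin ler_wpM2r// ltW// beta_weight_gt0.
Qed.

Lemma beta_intZ r s g k : 0 <= k ->
  (forall x, {for x, continuous g}) -> (forall x, 0 < x < 1 -> 0 <= g x) ->
  beta_int r s (fun x => k * g x) = (k%:E * beta_int r s g)%E.
Proof.
move=> k0 cg g0; rewrite /beta_int -ge0_integralZl//.
- by apply: eq_integral => x _; rewrite -EFinM -mulrA.
- apply/measurable_EFinP; apply: measurable_fun_oo; exact: continuous_mul_beta_weight.
- move=> x; rewrite /= in_itv/= => x01.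
  by rewrite lee_fin mulr_ge0 ?g0// ltW// beta_weight_gt0.
Qed.

Lemma beta_intD r s g h :
  (forall x, {for x, continuous g}) -> (forall x, {for x, continuous h}) ->
  (forall x, 0 < x < 1 -> 0 <= g x) -> (forall x, 0 < x < 1 -> 0 <= h x) ->
  beta_int r s (fun x => g x + h x) = (beta_int r s g + beta_int r s h)%E.
Proof.
move=> cg ch g0 h0; rewrite /beta_int -ge0_integralD//.
- by apply: eq_integral => x _; rewrite -EFinD mulrDl.
- move=> x; rewrite /= in_itv/= => x01.
  by rewrite lee_fin mulr_ge0 ?g0// ltW// beta_weight_gt0.
- apply/measurable_EFinP; apply: measurable_fun_oo; exact: continuous_mul_beta_weight.
- move=> x; rewrite /= in_itv/= => x01.
  by rewrite lee_fin mulr_ge0 ?h0// ltW// beta_weight_gt0.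
- apply/measurable_EFinP; apply: measurable_fun_oo; exact: continuous_mul_beta_weight.
Qed.

Lemma beta_int1_lty r s : 1 <= r -> 1 <= s -> (beta_int r s (cst 1%R) < +oo)%E.
Proof.
move=> r1 s1; apply: (@le_lt_trans _ _ (\int[mu]_(x in `]0%R, 1%R[) 1%:E)%E).
  apply: ge0_le_integral => //.
  - move=> x; rewrite /= in_itv/= => x01.
    by rewrite lee_fin mul1r ltW// beta_weight_gt0.
  - apply/measurable_EFinP; apply: measurable_fun_oo.
    by apply: continuous_mul_beta_weight => x; exact: cvg_cst.
  - move=> x; rewrite /= in_itv/= => x01.
    by rewrite lee_fin mul1r beta_weight_le1.
by rewrite integral_cst//= lebesgue_measure_itv/= lte01 mul1e oppr0 adde0 ltry.
Qed.

Lemma beta_int1E r s : 1 <= r -> 1 <= s ->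
  beta_int r s (cst 1) = (beta_integral r s)%:E.
Proof.
move=> r1 s1; have fin : beta_int r s (cst 1) \is a fin_num.
  rewrite ge0_fin_numE; first exact: beta_int1_lty.
  by apply: beta_int_ge0 => x _; exact: ler01.
rewrite -(fineK fin); congr EFin; congr fine.
rewrite /beta_int -(@integral_itv_bndoo _ 0 1 _ true false).
  by apply: eq_integral => x _; rewrite mul1r.
apply/measurable_EFinP; apply: measurable_fun_oo.
by apply: continuous_mul_beta_weight => x; exact: cvg_cst.
Qed.

Lemma beta_integral_gt0 r s : 1 <= r -> 1 <= s -> 0 < beta_integral r s.
Proof.
move=> r1 s1; rewrite -lte_fin -beta_int1E//.
have mf r' s' : measurable_fun (`]0, 1[ : set (measurableTypeR R))
    (fun x => (1 * beta_weight r' s' x)%:E).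
  apply/measurable_EFinP; apply: measurable_fun_oo.
  by apply: continuous_mul_beta_weight => x; exact: cvg_cst.
(* on [1/4, 1/2] both factors of the weight are at least those of [k] *)
pose k : R := 4^-1 `^ (r - 1) * 4^-1 `^ (s - 1).
have k0 : 0 < k by rewrite mulr_gt0// powR_gt0.
apply: (@lt_le_trans _ _ (\int[mu]_(x in `[4^-1%R, 2^-1%R]) k%:E)%E).
  rewrite integral_cst//= lebesgue_measure_itv/= lte_fin ltf_pV2 ?posrE// ltr_nat/=.
  by rewrite -EFinB -EFinM lte_fin mulr_gt0//; lra.
apply: (@le_trans _ _ (\int[mu]_(x in `[4^-1%R, 2^-1%R]) (1 * beta_weight r s x)%:E)%E).
  apply: ge0_le_integral => //.
  - by move=> x _; rewrite lee_fin ltW.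
  - apply: (measurable_funS _ _ (mf r s)) => //.
    by apply: subset_itv; rewrite bnd_simp; lra.
  - move=> x; rewrite /= in_itv/= => /andP[x4 x2]; rewrite lee_fin mul1r.
    by rewrite ler_pM ?powR_ge0// ge0_ler_powR ?nnegrE ?subr_ge0//; lra.
apply: ge0_subset_integral => //.
- move=> x; rewrite /= in_itv/= => x01.
  by rewrite lee_fin mul1r ltW// beta_weight_gt0.
- by apply: subset_itv; rewrite bnd_simp; lra.
Qed.

End beta_moments.

(** * Moment identities for the beta weight *)

Lemma cvgr_exprn (R : realType) (T : Type) (F : set_system T) {FF : Filter F}
    (f : T -> R) (l : R) k :
  f x @[x --> F] --> l -> f x ^+ k @[x --> F] --> l ^+ k.
Proof.
move=> fl; elim: k => [|k ih]; first by under eq_fun do rewrite expr0; exact: cvg_cst.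
by under eq_fun do rewrite exprS; rewrite exprS; exact: cvgM.
Qed.

Ltac solve_continuous := move=> *; rewrite /continuous_at /=;
  repeat lazymatch goal with
  | |- context [fmap (cst _) _] => exact: cvg_cst
  | |- context [fmap (fun _ => ?c) _] => exact: cvg_cst
  | |- context [fmap (fun x => x) _] => exact: cvg_id
  | |- context [fmap (fun x => (@?f x) ^+ _) _] => apply: cvgr_exprn
  | |- context [fmap (fun x => (@?f x) * (@?g x)) _] => apply: cvgM
  | |- context [fmap (fun x => (@?f x) + (@?g x)) _] => apply: cvgD
  | |- context [fmap (@GRing.opp _) _] => apply: cvgN; exact: cvg_id
  | |- context [fmap (fun x => - (@?f x)) _] => apply: cvgN
  end.

Section beta_moment_identities.
Variable R : realType.
Implicit Types (r s x m : R).

(** The derivative of [x ^ r * (1 - x) ^ s] has integral 0. *)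
Lemma beta_integral_shift r s : 1 <= r -> 1 <= s ->
  r * beta_integral r (s + 1) = s * beta_integral (r + 1) s.
Proof.
move=> r1 s1.
have cw r' s' k x : 0 < x < 1 ->
    {for x, continuous (fun x => k * beta_weight r' s' x)}.
  by apply: (@continuous_mul_beta_weight _ r' s' (cst k)); solve_continuous.
have w0 r' s' k x : 0 <= k -> 0 < x < 1 -> 0 <= k * beta_weight r' s' x.
  by move=> k0 x01; rewrite mulr_ge0// ltW// beta_weight_gt0.
have [G0 G1] : beta_weight (r + 1) (s + 1) x @[x --> 0^'+] --> (0 : R) /\
    beta_weight (r + 1) (s + 1) x @[x --> 1^'-] --> (0 : R).
  apply: (@cvg0_beta_weight_bound _ (r + 1) (s + 1) 1); [lra|lra|].
  by move=> x x01; rewrite mul1r gtr0_norm// beta_weight_gt0.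
have := @integral_eq_of_derive R (beta_weight (r + 1) (s + 1))
  (fun x => r * beta_weight r (s + 1) x) (fun x => s * beta_weight (r + 1) s x).
have E k r' s' : 0 <= k -> 1 <= r' -> 1 <= s' ->
   (\int[lebesgue_measure]_(x in `]0%R, 1%R[) (k * beta_weight r' s' x)%:E)%E
     = (k * beta_integral r' s')%:E.
  move=> k0 r1' s1'; rewrite EFinM -beta_int1E// -(@beta_intZ _ _ _ (cst 1))//.
  - by apply: eq_integral => x _; rewrite mulr1.
  - by solve_continuous.
rewrite !E; [|lra..] => /(_ _ _ _ _ _ G0 G1) H; apply/EFin_inj/H => x x01.
- apply: is_derive_eq; first exact: is_derive_beta_weight.
  rewrite !beta_weightSl// !beta_weightSr//.
  have /andP[x0 x1] := x01; have y0 : 0 < 1 - x by rewrite subr_gt0.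
  by field; rewrite !gt_eqF.
- exact: cw.
- exact: cw.
- by apply: w0 => //; lra.
- by apply: w0 => //; lra.
Qed.

Lemma beta_integral_split r s : 1 <= r -> 1 <= s ->
  beta_integral r s = beta_integral (r + 1) s + beta_integral r (s + 1).
Proof.
move=> r1 s1; apply: EFin_inj; rewrite EFinD -!beta_int1E//; [|lra..].
have E : beta_int r s (cst 1) = beta_int r s (fun x => x + (1 - x)).
  by apply: eq_integral => x _; rewrite addrC subrK.
rewrite E beta_intD; [|by solve_continuous|by solve_continuous| |]; last 2 first.
- by move=> x /andP[/ltW].
- by move=> x /andP[_ x1]; rewrite subr_ge0 ltW.
congr (_ + _)%E; apply: eq_integral => x; rewrite inE/= in_itv/= => x01.
  by rewrite beta_weightSl// mul1r.
by rewrite beta_weightSr// mul1r.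
Qed.

Lemma beta_integralSl r s : 1 <= r -> 1 <= s ->
  (r + s) * beta_integral (r + 1) s = r * beta_integral r s.
Proof.
move=> r1 s1; rewrite (beta_integral_split r1 s1) mulrDr (beta_integral_shift r1 s1).
by ring.
Qed.

Lemma beta_integralSr r s : 1 <= r -> 1 <= s ->
  (r + s) * beta_integral r (s + 1) = s * beta_integral r s.
Proof.
move=> r1 s1; rewrite (beta_integral_split r1 s1) mulrDr -(beta_integral_shift r1 s1).
by ring.
Qed.

(** Integration by parts against [x ^ r * (1 - x) ^ s], which turns a central
    moment of order [k + 2] into one of order [k]. *)
Lemma beta_int_stein r s k : 1 <= r -> 1 <= s -> ~~ odd k ->
  beta_int r s (fun x => k.+1%:R * (x - r / (r + s)) ^+ k * (x * (1 - x))) =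
  beta_int r s (fun x => (r + s) * (x - r / (r + s)) ^+ k.+2).
Proof.
move=> r1 s1 ek; set m := r / (r + s).
have rs0 : 0 < r + s by lra.
pose G x := (x - m) ^+ k.+1 * beta_weight (r + 1) (s + 1) x.
have m01 : 0 <= m <= 1.
  rewrite /m divr_ge0/=; [|lra..].
  by rewrite ler_pdivrMr// mul1r; lra.
have [G0 G1] : G x @[x --> 0^'+] --> (0 : R) /\ G x @[x --> 1^'-] --> (0 : R).
  apply: (@cvg0_beta_weight_bound _ (r + 1) (s + 1) 1); [lra|lra|].
  move=> x x01; rewrite normrM (gtr0_norm (beta_weight_gt0 _ _ x01)).
  rewrite ler_wpM2r ?(ltW (beta_weight_gt0 _ _ x01))// normrX exprn_ile1//.
  by rewrite ler_norml; lra.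
apply: (@integral_eq_of_derive R G) G0 G1 => x x01.
- have /andP[x0 x1] := x01; have y0 : 0 < 1 - x by rewrite subr_gt0.
  have d1 := is_derive_beta_weight (r + 1) (s + 1) x01.
  have d2 : is_derive x 1 ((fun y => y ^+ k.+1) \o (fun x => x - m))
     (k.+1%:R * (x - m) ^+ k * (1 - 0)).
    apply: is_derive1_comp; apply: DeriveDef; first exact: exprn_derivable.
    by rewrite exp_derive /GRing.scale/= mulr1.
  have := is_deriveM d2 d1; rewrite /= => d.
  apply: is_derive_eq; rewrite /GRing.scale/= beta_weightSl// beta_weightSr//.
  by rewrite !exprS /m; field; rewrite !gt_eqF.
- by apply: continuous_mul_beta_weight => //; solve_continuous.
- by apply: continuous_mul_beta_weight => //; solve_continuous.
- have /andP[x0 x1] := x01.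
  rewrite mulr_ge0 ?(ltW (beta_weight_gt0 _ _ x01))//.
  by rewrite !mulr_ge0 ?exprn_even_ge0//; lra.
- rewrite mulr_ge0 ?(ltW (beta_weight_gt0 _ _ x01))//.
  by rewrite mulr_ge0 ?exprn_even_ge0//= ?negbK//; lra.
Qed.

End beta_moment_identities.

(** * Moment bounds for the beta weight *)

Section beta_moment_bounds.
Variable R : realType.
Implicit Types (r s x m : R).

(** The moment identity is used twice, with [x * (1 - x) <= 1 / 4]; each use
    gains a factor of order [1 / (r + s)]. *)
Lemma beta_int_moment4 r s : 1 <= r -> 1 <= s ->
  (beta_int r s (fun x => ((x - r / (r + s)) ^+ 4)%R) <=
     (3 / (16 * (r + s) ^+ 2) * beta_integral r s)%:E)%E.
Proof.
move=> r1 s1; set m := r / (r + s).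
have N0 : 0 < r + s by lra.
have step k (C : R) : ~~ odd k ->
    (beta_int r s (fun x => ((x - m) ^+ k)%R) <= C%:E)%E ->
    (beta_int r s (fun x => ((x - m) ^+ k.+2)%R) <=
       (k.+1%:R / (4 * (r + s)) * C)%:E)%E.
  move=> ek kC.
  rewrite (_ : _ * C = (r + s)^-1 * (k.+1%:R / 4 * C)); last first.
    by field; rewrite gt_eqF.
  rewrite EFinM lee_pdivlMl// -beta_intZ//; [|exact: ltW|by solve_continuous|]; last first.
    by move=> x _; rewrite exprn_even_ge0//= negbK.
  rewrite -beta_int_stein//.
  apply: (@le_trans _ _ (beta_int r s (fun x => (k.+1%:R / 4 * (x - m) ^+ k)%R))).
    apply: le_beta_int; [by solve_continuous|by solve_continuous|].
    move=> x /andP[x0 x1]; rewrite !mulr_ge0 ?exprn_even_ge0//=; [|lra..].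
    rewrite mulrAC ler_wpM2r ?exprn_even_ge0// ler_wpM2l//.
    by have := sqr_ge0 (x - 1 / 2); rewrite expr2; lra.
  rewrite beta_intZ//; [|by solve_continuous|].
    by rewrite [leRHS]EFinM; apply: lee_wpmul2l => //; rewrite lee_fin mulr_ge0.
  by move=> x _; rewrite exprn_even_ge0.
have s0 := @step 0 (beta_integral r s) isT _.
have s2 := @step 2 _ isT (s0 _).
have -> : 3 / (16 * (r + s) ^+ 2) * beta_integral r s =
   3 / (4 * (r + s)) * (1 / (4 * (r + s)) * beta_integral r s).
  by field; rewrite gt_eqF.
apply: s2; rewrite -beta_int1E//; apply: le_beta_int => *; rewrite ?expr0 ?lexx ?ler01//; exact: cvg_cst.
Qed.

(** The exponents [a - 1] and [b - 2] absorb the factor [x^-1 * (1 - x)^-2] of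
    the squared score. The mean of the shifted law differs from [a / (a + b)] by
    [dl], of order [1 / N], whose fourth power is negligible. *)
Lemma beta_int_moment4_shift (a b : R) : 16 <= a -> 16 <= b ->
  (beta_int (a - 1)%R (b - 2)%R (fun x => ((x - a / (a + b)) ^+ 4)%R) <=
     (8 / (a + b) ^+ 2 * beta_integral (a - 1) (b - 2))%:E)%E.
Proof.
move=> a16 b16; set N := a + b.
have N32 : 32 <= N by rewrite /N; lra.
have -> : a / N = (a - 1) / (a - 1 + (b - 2)) - (3 * a - N) / (N * (N - 3)).
  rewrite /N; field; rewrite -/N; do !(apply/andP; split); rewrite gt_eqF//; lra.
set m := (a - 1) / _; set dl := (3 * a - N) / _.
have dl4 : dl ^+ 4 <= 1 / (4 * N ^+ 2).
  have dl_le : `|dl| <= 4 / N.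
    have D0 : 0 < N * (N - 3) by rewrite mulr_gt0//; lra.
    rewrite /dl normrM normfV (gtr0_norm D0) ler_pdivrMr//.
    rewrite (_ : 4 / N * _ = 4 * (N - 3)); last by field; rewrite gt_eqF; lra.
    by rewrite ler_norml; apply/andP; split; rewrite /N; lra.
  have -> : dl ^+ 4 = `|dl| ^+ 4 by rewrite -normrX ger0_norm// exprn_even_ge0.
  apply: (@le_trans _ _ ((4 / N) ^+ 4)).
    by rewrite ler_pXn2r// nnegrE divr_ge0//; lra.
  have -> : (4 / N) ^+ 4 = (32 / N) ^+ 2 * (1 / (4 * N ^+ 2)).
    by field; rewrite gt_eqF; lra.
  have N2 : 0 <= 1 / (4 * N ^+ 2) by rewrite divr_ge0// mulr_ge0// sqr_ge0.
  apply: (ler_piMl N2); rewrite exprn_ile1//; first by rewrite divr_ge0//; lra.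
  by rewrite ler_pdivrMr ?mul1r//; lra.
apply: (@le_trans _ _ (beta_int (a - 1)%R (b - 2)%R
    (fun x => (8 * (x - m) ^+ 4 + 8 * dl ^+ 4)%R))).
  apply: le_beta_int; [by solve_continuous|by solve_continuous|].
  move=> x _; rewrite exprn_even_ge0//=.
  have -> : x - (m - dl) = (x - m) + dl by ring.
  set u := x - m.
  (* convexity of the fourth power, as an explicit sum of squares *)
  have -> : 8 * u ^+ 4 + 8 * dl ^+ 4 = (u + dl) ^+ 4 +
      (u - dl) ^+ 2 * (7 * u ^+ 2 + 10 * u * dl + 7 * dl ^+ 2).
    ring.
  rewrite lerDl mulr_ge0 ?sqr_ge0//.
  have -> : 7 * u ^+ 2 + 10 * u * dl + 7 * dl ^+ 2 =
      5 * (u + dl) ^+ 2 + 2 * u ^+ 2 + 2 * dl ^+ 2 by ring.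
  by rewrite !addr_ge0// mulr_ge0// sqr_ge0.
rewrite beta_intD; [|by solve_continuous|by solve_continuous| |]; last 2 first.
- by move=> x _; rewrite mulr_ge0// exprn_even_ge0.
- by move=> x _; rewrite mulr_ge0// exprn_even_ge0.
rewrite beta_intZ//; [|by solve_continuous|by move=> *; rewrite exprn_even_ge0].
rewrite (_ : beta_int _ _ (fun=> 8 * dl ^+ 4) =
    (8 * dl ^+ 4 * beta_integral (a - 1) (b - 2))%:E); last first.
  have d0 : 0 <= 8 * dl ^+ 4 by rewrite mulr_ge0// exprn_even_ge0.
  rewrite EFinM -beta_int1E; [|lra..].
  rewrite -(beta_intZ _ _ d0)//; last by solve_continuous.
  by apply: eq_integral => x _; rewrite /= mulr1.
have B0 : 0 < beta_integral (a - 1) (b - 2) by apply: beta_integral_gt0; lra.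
apply: (@le_trans _ _ (8%:E * (3 / (16 * (N - 3) ^+ 2) *
    beta_integral (a - 1) (b - 2))%:E +
    (8 * dl ^+ 4 * beta_integral (a - 1) (b - 2))%:E)%E).
  apply: leeD => //; apply: lee_wpmul2l => //.
  have := @beta_int_moment4 (a - 1) (b - 2).
  have -> : a - 1 + (b - 2) = N - 3 by rewrite /N; ring.
  by rewrite /m (_ : a - 1 + (b - 2) = N - 3); [apply; lra|rewrite /N; ring].
rewrite -EFinM -EFinD lee_fin mulrA -mulrDl ler_wpM2r ?(ltW B0)//.
have N3 : 3 / (16 * (N - 3) ^+ 2) <= 3 / (4 * N ^+ 2).
  rewrite ler_pM2l// lef_pV2 ?posrE ?mulr_gt0 ?exprn_gt0//; [|lra..].
  by have := sqr_ge0 (N - 6); rewrite !expr2; nra.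
have -> : 8 / N ^+ 2 = 8 * (3 / (4 * N ^+ 2)) + 8 * (1 / (4 * N ^+ 2)).
  by field; rewrite gt_eqF; lra.
by rewrite lerD// ler_wpM2l.
Qed.

(** Three unit steps of the recursion for the beta integral. For parameters at
    least 16, the numbers [a - 1], [b - 1] and [b - 2] exceed [a / 2], [b / 2]
    and [b / 2], hence the factor 8. *)
Lemma beta_integral_shift_le (a b : R) : 16 <= a -> 16 <= b ->
  beta_integral (a - 1) (b - 2) <=
    8 * (a + b) ^+ 3 / (a * b ^+ 2) * beta_integral a b.
Proof.
move=> a16 b16.
have [a1 b1 b2] : [/\ 1 <= a - 1, 1 <= b - 1 & 1 <= b - 2] by split; lra.
have a0 : 1 <= a by lra.
have NZ : [/\ a - 1 != 0, b - 1 != 0 & b - 2 != 0].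
  by split; rewrite gt_eqF//; lra.
have B0 : 0 < beta_integral a b by apply: beta_integral_gt0; lra.
have E1 := @beta_integralSl R (a - 1) (b - 2).
have E2 := @beta_integralSr R a (b - 2).
have E3 := @beta_integralSr R a (b - 1).
rewrite !subrK in E1 E3; rewrite (_ : b - 2 + 1 = b - 1) in E2; last ring.
have {}E1 := E1 a1 b2; have {}E2 := E2 a0 b2; have {}E3 := E3 a0 b1.
set N := a + b in E1 E2 E3 *; set x := beta_integral (a - 1) (b - 2) in E1 *.
have -> : x = (N - 1) * (N - 2) * (N - 3) / ((a - 1) * (b - 1) * (b - 2)) *
    beta_integral a b.
  rewrite (_ : a - 1 + (b - 2) = N - 3) in E1; last by rewrite /N; ring.
  rewrite (_ : a + (b - 2) = N - 2) in E2; last by rewrite /N; ring.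
  rewrite (_ : a + (b - 1) = N - 1) in E3; last by rewrite /N; ring.
  have {a1 b1 b2}[a1 b1 b2] := NZ.
  apply: (mulfI a1); rewrite -E1; apply: (mulfI b2).
  rewrite mulrCA -E2; apply: (mulfI b1).
  rewrite !(mulrCA (b - 1)) -E3.
  by field; rewrite a1 b1 b2.
clear E1 E2 E3 NZ x; rewrite ler_wpM2r ?(ltW B0)//.
rewrite ler_pdivrMr; last by rewrite !mulr_gt0//; lra.
rewrite [leRHS]mulrAC ler_pdivlMr; [|by rewrite mulr_gt0 ?exprn_gt0//; lra].
have -> : 8 * N ^+ 3 * ((a - 1) * (b - 1) * (b - 2)) =
   (N * N * N) * (2 * (a - 1) * (2 * (b - 1)) * (2 * (b - 2))) by ring.
rewrite /N; apply: ler_pM.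
- by rewrite !mulr_ge0//; lra.
- by rewrite !mulr_ge0//; lra.
- by do 2 (apply: ler_pM; rewrite ?mulr_ge0//; try lra).
- by rewrite expr2 mulrA; do 2 (apply: ler_pM; rewrite ?mulr_ge0//; try lra).
Qed.

(** The integrand is the pointwise bound for the squared score defect, cleared
    of its singularities. In [520 = 8 * 65] the factor 65 is [8 * 8 + 1], from
    the fourth moment and the constant term, and 8 is the quotient of the two
    beta integrals. *)
Lemma beta_int_defect_le (a b N m2 : R) : 16 <= a -> 16 <= b ->
  N = a + b -> m2 = a / N ->
  (beta_int (a - 1)%R (b - 2)%R
      (fun x => (8 / m2 ^+ 2 * (x - m2) ^+ 4 + 1 / (2 * N ^+ 2))%R) <=
     (520 / (m2 ^+ 3 * (1 - m2) ^+ 2 * N ^+ 2) * beta_integral a b)%:E)%E.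
Proof.
move=> a16 b16 NE m2E.
have N0 : 32 <= N by rewrite NE; lra.
have m01 : 0 < m2 < 1.
  by rewrite m2E divr_gt0/= ?ltr_pdivrMr ?mul1r//; lra.
have /andP[m0 m1] := m01.
have B0 : 0 < beta_integral a b by apply: beta_integral_gt0; lra.
have B1 : 0 < beta_integral (a - 1) (b - 2) by apply: beta_integral_gt0; lra.
have c8 : 0 <= 8 / m2 ^+ 2 by rewrite divr_ge0// sqr_ge0.
have cN : 0 <= 1 / (2 * N ^+ 2) by rewrite divr_ge0// mulr_ge0// sqr_ge0.
rewrite beta_intD; [|by solve_continuous|by solve_continuous| |]; last 2 first.
- by move=> x _; rewrite mulr_ge0// exprn_even_ge0.
- by [].
rewrite beta_intZ//; [|by solve_continuous|by move=> *; rewrite exprn_even_ge0].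
have -> : beta_int (a - 1) (b - 2) (fun=> 1 / (2 * N ^+ 2)) =
   (1 / (2 * N ^+ 2) * beta_integral (a - 1) (b - 2))%:E.
  rewrite EFinM -beta_int1E; [|lra..].
  rewrite -(beta_intZ _ _ cN)//; last by solve_continuous.
  by apply: eq_integral => x _; rewrite /= mulr1.
apply: (@le_trans _ _ ((8 / m2 ^+ 2)%:E *
    (8 / N ^+ 2 * beta_integral (a - 1) (b - 2))%:E +
    (1 / (2 * N ^+ 2) * beta_integral (a - 1) (b - 2))%:E)%E).
  apply: leeD => //; apply: lee_wpmul2l => //.
  by rewrite m2E NE; exact: beta_int_moment4_shift.
rewrite -EFinM -EFinD lee_fin mulrA -mulrDl.
have c1 : 8 / m2 ^+ 2 * (8 / N ^+ 2) + 1 / (2 * N ^+ 2) <= 65 / (m2 ^+ 2 * N ^+ 2).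
  have -> : 65 / (m2 ^+ 2 * N ^+ 2) = 8 / m2 ^+ 2 * (8 / N ^+ 2) + 1 / (m2 ^+ 2 * N ^+ 2).
    by field; rewrite !gt_eqF//; lra.
  rewrite lerD2l !div1r lef_pV2 ?posrE ?mulr_gt0 ?exprn_gt0//; [|lra..].
  rewrite ler_wpM2r ?sqr_ge0// (le_trans (y := 1)) ?ler1n//.
  by rewrite exprn_ile1// ltW.
apply: le_trans (ler_wpM2r (ltW B1) c1) _.
apply: (@le_trans _ _ (65 / (m2 ^+ 2 * N ^+ 2) *
    (8 * (a + b) ^+ 3 / (a * b ^+ 2) * beta_integral a b))).
  rewrite ler_wpM2l; last exact: beta_integral_shift_le.
    by [].
  by rewrite divr_ge0// mulr_ge0// sqr_ge0.
rewrite mulrA ler_wpM2r ?(ltW B0)// le_eqVlt; apply/orP; left; apply/eqP.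
rewrite m2E NE; field.
by rewrite !gt_eqF//; lra.
Qed.

End beta_moment_bounds.

(** * The beta law as a probability measure *)

(** A density agrees almost everywhere with the Radon-Nikodym derivative, for
    which the change of variables holds. *)
Lemma ge0_integral_density (d : measure_display) (T : measurableType d)
    (R : realType) (nu : {finite_measure set T -> \bar R})
    (mu : {sigma_finite_measure set T -> \bar R}) (f g : T -> \bar R) :
  measurable_fun setT f -> (forall x, 0 <= f x)%E ->
  (forall A, measurable A -> nu A = \int[mu]_(x in A) f x)%E ->
  measurable_fun setT g -> (forall x, 0 <= g x)%E ->
  (\int[nu]_x g x = \int[mu]_x (g x * f x))%E.
Proof.
move=> mf f0 nuE mg g0.
have numu : nu `<< mu.
  apply/null_content_dominatesP => A mA A0; rewrite nuE//.
  by apply: null_set_integral => //; exact: measurable_funTS.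
rewrite -(Radon_Nikodym_SigmaFinite.change_of_variables numu)//.
have fi := Radon_Nikodym_SigmaFinite.f_integrable numu.
apply: ae_eq_integral => //.
- by apply: emeasurable_funM => //; exact: measurable_int fi.
- exact: emeasurable_funM.
- have := integral_ae_eq measurableT fi mf.
  case; first by move=> E _ mE; rewrite -(Radon_Nikodym_SigmaFinite.f_integral numu)// nuE.
  move=> N [mN N0 sN]; exists N; split => //; apply: subset_trans sN => x /= h H.
  by apply: h => _; rewrite H.
Qed.

Section beta_law_measure.
Variables (R : realType) (r s : R).
Local Notation mu := (@lebesgue_measure R).

Lemma beta_weight_ge0 x : 0 <= beta_weight r s x.
Proof. by rewrite mulr_ge0 ?powR_ge0. Qed.

Definition beta_density (x : R) : R := beta_weight r s x / beta_integral r s.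

Lemma beta_density_ge0 x : 0 <= beta_density x.
Proof.
rewrite divr_ge0 ?beta_weight_ge0//; apply: Rintegral_ge0 => y _.
exact: beta_weight_ge0.
Qed.

Lemma measurable_beta_density :
  measurable_fun [set: measurableTypeR R] beta_density.
Proof.
apply: measurable_funM => //; apply: measurable_funM.
  exact: measurable_powR.
apply: (measurableT_comp (f := fun y : R => y `^ (s - 1))).
  exact: measurable_powR.
exact: measurable_funB.
Qed.

Lemma measurable_patch_beta_density :
  measurable_fun [set: measurableTypeR R] ((EFin \o beta_density) \_ `[0, 1]).
Proof.
have mI : @measurable _ (measurableTypeR R) `[0, 1] by exact: measurable_itv.
apply: (measurable_restrictT (EFin \o beta_density) mI).1.
apply: measurable_funTS; apply/measurable_EFinP.
exact: measurable_beta_density.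
Qed.

Definition beta_measure (A : set (measurableTypeR R)) : \bar R :=
  beta_law r s A.

Lemma beta_measureE A : beta_measure A =
  (\int[mu]_(x in A) ((EFin \o beta_density) \_ `[0%R, 1%R]) x)%E.
Proof. by rewrite /beta_measure /beta_law integral_mkcondr. Qed.

Let patch_ge0 x : (0 <= ((EFin \o beta_density) \_ `[0%R, 1%R]) x)%E.
Proof. by apply: erestrict_ge0 => y _; rewrite lee_fin beta_density_ge0. Qed.

Let beta_measure0 : beta_measure set0 = 0%E.
Proof. by rewrite beta_measureE integral_set0. Qed.

Let beta_measure_ge0 A : (0 <= beta_measure A)%E.
Proof. by rewrite beta_measureE integral_ge0. Qed.

Let beta_measure_sigma_additive : semi_sigma_additive beta_measure.
Proof.
move=> /= A mA tA mUA; rewrite beta_measureE ge0_integral_bigcup//; last first.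
  by apply: measurable_funTS; exact: measurable_patch_beta_density.
under eq_fun do under eq_bigr do rewrite beta_measureE.
apply: is_cvg_ereal_nneg_natsum_cond => n _ _.
by rewrite integral_ge0.
Qed.

HB.instance Definition _ := isMeasure.Build _ _ _ beta_measure
  beta_measure0 beta_measure_ge0 beta_measure_sigma_additive.

Hypotheses (r1 : 1 <= r) (s1 : 1 <= s).

Lemma beta_measure_setT : beta_measure setT = 1%E.
Proof.
have B0 := beta_integral_gt0 r1 s1.
rewrite /beta_measure /beta_law setTI.
have mw : measurable_fun (`]0, 1[ : set (measurableTypeR R))
    (fun x => (beta_weight r s x)%:E).
  apply/measurable_EFinP; apply: measurable_fun_oo => x x01.
  exact: continuous_beta_weight.
rewrite (integral_itv_bndoo (f := fun x => (beta_weight r s x / _)%:E)); last first.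
  apply/measurable_EFinP; apply: measurable_funM => //.
  by apply/measurable_EFinP.
transitivity ((beta_integral r s)^-1%:E * beta_int r s (cst 1%R))%E.
  have -> : beta_int r s (cst 1) = (\int[mu]_(x in `]0%R, 1%R[) (beta_weight r s x)%:E)%E.
    by apply: eq_integral => x _; rewrite /= mul1r.
  rewrite -ge0_integralZl//.
  - by apply: eq_integral => x _; rewrite -EFinM mulrC.
  - by move=> x _; rewrite lee_fin beta_weight_ge0.
  - by rewrite lee_fin invr_ge0 ltW.
by rewrite beta_int1E// -EFinM mulVf// gt_eqF.
Qed.

Definition beta_probability : probability (measurableTypeR R) R :=
  HB.pack_for (probability (measurableTypeR R) R) beta_measure
    (Measure_isProbability.Build _ _ _ beta_measure beta_measure_setT).

Lemma integral_beta_probability (g : R -> \bar R) :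
  measurable_fun [set: measurableTypeR R] g -> (forall x, 0 <= g x)%E ->
  (\int[beta_probability]_x g x =
   \int[mu]_(x in `]0%R, 1%R[) (g x * (beta_density x)%:E))%E.
Proof.
move=> mg g0.
rewrite (@ge0_integral_density _ _ _ beta_probability mu
  ((EFin \o beta_density) \_ `[0%R, 1%R]))//; last 2 first.
- exact: measurable_patch_beta_density.
- by move=> A mA; rewrite -beta_measureE.
rewrite -(integral_itv_bndoo (x := 0) (y := 1)
  (f := (fun x => g x * (beta_density x)%:E)%E) true false).
  rewrite [RHS]integral_mkcond; apply: eq_integral => x _.
  by rewrite !patchE; case: ifPn => // _; rewrite mule0.
apply: emeasurable_funM; first exact: measurable_funTS.
by apply/measurable_EFinP; apply: measurable_funTS; exact: measurable_beta_density.
Qed.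

End beta_law_measure.

(** * Distribution functions and the standard normal law *)

Section real_cdf.
Variable R : realType.
Implicit Types (P : probability (measurableTypeR R) R) (x y : R).
Local Notation mu := (@lebesgue_measure R).

Definition rcdf P x : R := fine (P `]-oo, x]%classic).

Lemma EFin_rcdf P x : (rcdf P x)%:E = P `]-oo, x]%classic.
Proof. by rewrite fineK// fin_num_measure. Qed.

Lemma rcdf_ge0 P x : 0 <= rcdf P x.
Proof. by rewrite -lee_fin EFin_rcdf. Qed.

Lemma rcdf_le1 P x : rcdf P x <= 1.
Proof. by rewrite -lee_fin EFin_rcdf probability_le1. Qed.

Lemma le_rcdf P x y : x <= y -> rcdf P x <= rcdf P y.
Proof.
move=> xy; rewrite -lee_fin !EFin_rcdf le_measure ?inE//.
by apply: subset_itvl; rewrite bnd_simp.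
Qed.

Lemma rcdf_gt_exists P (e : R) : e < 1 -> exists x, e < rcdf P x.
Proof.
move=> e1.
have mid : @measurable_fun _ _ (measurableTypeR R) R setT idfun by exact: measurable_id.
pose X : {mfun measurableTypeR R >-> R} :=
  HB.pack (idfun : measurableTypeR R -> R) (isMeasurableFun.Build _ _ _ _ _ mid).
have /fine_cvgP[_ /cvgr_gt/(_ _ e1)] := @cvg_cdfy1 _ _ _ P X.
move=> /= h; near (+oo : set_system R) => x.
by exists x; near: x.
Unshelve. all: by end_near. Qed.

Lemma rcdf_lt_exists P (e : R) : 0 < e -> exists x, rcdf P x < e.
Proof.
move=> e0.
have mid : @measurable_fun _ _ (measurableTypeR R) R setT idfun by exact: measurable_id.
pose X : {mfun measurableTypeR R >-> R} :=
  HB.pack (idfun : measurableTypeR R -> R) (isMeasurableFun.Build _ _ _ _ _ mid).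
have /fine_cvgP[_ /cvgr_lt/(_ _ e0)] := @cvg_cdfNy0 _ _ _ P X.
move=> /= h; near (-oo : set_system R) => x.
by exists x; near: x.
Unshelve. all: by end_near. Qed.

Lemma is_derive_rcdf P (f : R -> R) x :
  measurable_fun [set: measurableTypeR R] f -> (forall y, 0 <= f y) ->
  (forall A, measurable A -> P A = \int[mu]_(y in A) (f y)%:E)%E ->
  {for x, continuous f} -> is_derive x 1 (rcdf P) (f x).
Proof.
move=> mf f0 PE cf.
have i1 : mu.-integrable `]-oo, x + 1] (EFin \o f).
  apply/integrableP; split.
    by apply/measurable_EFinP; exact: measurable_funTS.
  under eq_integral do rewrite /= ger0_norm//.
  rewrite -PE; last exact: measurable_itv.
  by rewrite (le_lt_trans (probability_le1 _ _)) ?ltry.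
have xx : x < x + 1 by rewrite ltrDl.
have [d1 d2] := continuous_FTC1 xx i1 (ltNyr _) cf.
have E : rcdf P = (fun x => \int[mu]_(t in `]-oo, x]) f t).
  by apply/funext => y; rewrite /rcdf PE//; exact: measurable_itv.
by rewrite E; apply: DeriveDef; [exact: d1|rewrite -derive1E; exact: d2].
Qed.

Lemma derive_mean_value (f df : R -> R) x y :
  (forall z, x <= z <= y -> is_derive z 1 f (df z)) -> x < y ->
  exists2 z, x < z < y & f y - f x = df z * (y - x).
Proof.
move=> dff xy.
have cf : {within `[x, y], continuous f}.
  apply: continuous_in_subspaceT => z; rewrite inE/= in_itv/= => /dff[d _].
  exact/differentiable_continuous/derivable1_diffP.
have df_oo z : z \in `]x, y[ -> is_derive z 1 f (df z).
  by rewrite in_itv/= => /andP[/ltW xz /ltW zy]; apply: dff; rewrite xz.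
have [z] := @MVT R f df x y xy df_oo cf.
by rewrite in_itv/= => zxy E; exists z.
Qed.

Lemma lt_of_derive_gt0 (f df : R -> R) x y :
  (forall z, x <= z <= y -> is_derive z 1 f (df z)) ->
  (forall z, x < z < y -> 0 < df z) -> x < y -> f x < f y.
Proof.
move=> dff df0 xy; rewrite -subr_gt0.
by have [z zxy ->] := derive_mean_value dff xy; rewrite mulr_gt0 ?df0// subr_gt0.
Qed.

Lemma le_of_derive_ge0 (f df : R -> R) x y :
  (forall z, x <= z <= y -> is_derive z 1 f (df z)) ->
  (forall z, x < z < y -> 0 <= df z) -> x <= y -> f x <= f y.
Proof.
move=> dff df0; rewrite le_eqVlt => /predU1P[->//|xy]; rewrite -subr_ge0.
have [z zxy ->] := derive_mean_value dff xy.
by rewrite mulr_ge0 ?df0// subr_ge0 ltW.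
Qed.

End real_cdf.

Section standard_normal.
Variable R : realType.
Implicit Types (x y t : R).

Definition gauss_pdf x : R := normal_pdf 0 1 x.
Definition gauss_cdf x : R := rcdf (normal_prob 0 1) x.

Lemma gauss_pdfE x : gauss_pdf x = normal_peak 1 * expR (- (x ^+ 2 / 2)).
Proof.
rewrite /gauss_pdf normal_pdfE ?oner_eq0// /normal_fun subr0 expr1n mulNr.
by congr (_ * expR (- (_ / _))); rewrite -mulr2n.
Qed.

Lemma gauss_pdf_gt0 x : 0 < gauss_pdf x.
Proof. by rewrite gauss_pdfE mulr_gt0 ?expR_gt0// normal_peak_gt0// oner_eq0. Qed.

Lemma is_derive_gauss_pdf x : is_derive x 1 gauss_pdf (- x * gauss_pdf x).
Proof.
rewrite (_ : gauss_pdf = fun x => normal_peak 1 * (expR \o (fun x => - (x ^+ 2 / 2))) x); last first.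
  by apply/funext => y; rewrite gauss_pdfE.
have d1 : is_derive x 1 (fun x : R => x ^+ 2) (2 * x).
  by apply: DeriveDef; [exact: exprn_derivable|rewrite exp_derive /GRing.scale/= mulr1 expr1].
have d2 : is_derive x 1 (fun x : R => - (x ^+ 2 / 2)) (- x).
  have := is_deriveN (is_deriveM d1 (is_derive_cst (2^-1 : R) x 1)).
  by move=> d; apply: is_derive_eq; rewrite /GRing.scale/=; field.
have d3 : is_derive x 1 (expR \o (fun x : R => - (x ^+ 2 / 2)))
    (expR (- (x ^+ 2 / 2)) * - x).
  exact: is_derive1_comp.
have := is_deriveM (is_derive_cst (normal_peak 1 : R) x 1) d3; rewrite /= => d.
by apply: is_derive_eq; rewrite /GRing.scale/=; ring.
Qed.

Lemma is_derive_gauss_cdf x : is_derive x 1 gauss_cdf (gauss_pdf x).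
Proof.
apply: is_derive_rcdf => //.
- exact: measurable_normal_pdf.
- by move=> y; exact: normal_pdf_ge0.
- by apply: continuous_normal_pdf; rewrite oner_eq0.
Qed.

Lemma gauss_cdf_lt x y : x < y -> gauss_cdf x < gauss_cdf y.
Proof.
apply: (@lt_of_derive_gt0 _ _ gauss_pdf) => z _; first exact: is_derive_gauss_cdf.
exact: gauss_pdf_gt0.
Qed.

Lemma gauss_cdf_itv x : 0 < gauss_cdf x < 1.
Proof.
have lt1 : x - 1 < x by rewrite ltrBlDr ltrDl.
have lt2 : x < x + 1 by rewrite ltrDl.
rewrite (le_lt_trans (rcdf_ge0 _ _) (gauss_cdf_lt lt1))/=.
by rewrite (lt_le_trans (gauss_cdf_lt lt2))// rcdf_le1.
Qed.

Lemma gauss_cdf_le_mono : {mono gauss_cdf : x y / x <= y}.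
Proof. by apply: le_mono => x y; exact: gauss_cdf_lt. Qed.

Lemma continuous_gauss_cdf : continuous gauss_cdf.
Proof.
move=> x; have [d _] := is_derive_gauss_cdf x.
exact/differentiable_continuous/derivable1_diffP.
Qed.

Lemma gauss_cdf_surj y : 0 < y < 1 -> exists x, gauss_cdf x = y.
Proof.
move=> /andP[y0 y1].
have [a ay] := rcdf_lt_exists (normal_prob 0 1) y0.
have [b yb] := rcdf_gt_exists (normal_prob 0 1) y1.
have ab : a <= b.
  by rewrite -gauss_cdf_le_mono ltW// (lt_trans ay yb).
have [||c _ <-] := @IVT R gauss_cdf a b y ab.
- exact/continuous_subspaceT/continuous_gauss_cdf.
- by rewrite ge_min (ltW ay)/= le_max (ltW yb) orbT.
- by exists c.
Qed.

Definition gauss_quantile y : R := xget 0 [set x | gauss_cdf x = y].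

Lemma gauss_quantileK y : 0 < y < 1 -> gauss_cdf (gauss_quantile y) = y.
Proof. by move=> /gauss_cdf_surj h; exact: (xgetPex 0 h). Qed.

Lemma gauss_cdfK : cancel gauss_cdf gauss_quantile.
Proof.
move=> x; apply: (inc_inj gauss_cdf_le_mono).
by rewrite gauss_quantileK// gauss_cdf_itv.
Qed.

Lemma is_derive_gauss_quantile y : 0 < y < 1 ->
  is_derive y 1 gauss_quantile (gauss_pdf (gauss_quantile y))^-1.
Proof.
move=> y01; rewrite -[in is_derive y](gauss_quantileK y01).
apply: is_derive_inverse.
- by near=> x; exact: gauss_cdfK.
- by near=> x; exact: continuous_gauss_cdf.
- exact: is_derive_gauss_cdf.
- by rewrite gt_eqF// gauss_pdf_gt0.
Unshelve. all: by end_near. Qed.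

(** From [1 + x <= expR x] the density is at most [2 / t ^ 2] up to a constant
    factor, which beats the linear growth of [`|t| + c]. *)
Lemma gauss_pdf_decay (c e : R) : 0 <= c -> 0 < e ->
  exists2 M, 0 < M & forall t, M <= `|t| -> (`|t| + c) * gauss_pdf t <= e.
Proof.
move=> c0 e0; set k : R := normal_peak 1.
have k0 : 0 < k by apply: normal_peak_gt0; rewrite oner_eq0.
exists (1 + 2 * k * (1 + c) / e).
  by rewrite ltr_wpDr// divr_ge0 ?ltW// !mulr_gt0//; lra.
move=> t tM; set u := `|t| in tM *.
have u1 : 1 <= u.
  by rewrite (le_trans _ tM)// lerDl divr_ge0 ?(ltW e0)// !mulr_ge0 ?(ltW k0)//; lra.
have uM : 2 * k * (1 + c) <= e * u.
  by rewrite [leRHS]mulrC -ler_pdivrMr// (le_trans _ tM)// lerDr.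
have E : expR (- (t ^+ 2 / 2)) <= 2 / u ^+ 2.
  rewrite expRN -(invrK (2 / u ^+ 2)) lef_pV2 ?posrE ?expR_gt0 ?invr_gt0 ?divr_gt0 ?exprn_gt0//; [|lra].
  rewrite invf_div -(real_normK (num_real t)) -/u.
  by rewrite (le_trans _ (expR_ge1Dx _))// lerDr.
rewrite gauss_pdfE -/k.
apply: (@le_trans _ _ (((1 + c) * u) * (k * (2 / u ^+ 2)))).
  apply: ler_pM; rewrite ?addr_ge0 ?mulr_ge0 ?(ltW k0) ?expR_ge0//; first lra.
    by nra.
  by rewrite ler_wpM2l ?(ltW k0).
rewrite (_ : _ * _ = 2 * k * (1 + c) / u); last by field; rewrite gt_eqF; lra.
by rewrite ler_pdivrMr; lra.
Qed.

End standard_normal.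

Arguments gauss_pdf {R} x.
Arguments gauss_cdf {R} x.
Arguments gauss_quantile {R} y.

(** * The monotone map from the beta law to the normal law *)

Section beta_transport.
Variables (R : realType) (r s : R) (r1 : 1 <= r) (s1 : 1 <= s).
Implicit Types u v x : R.
Local Notation mu := (@lebesgue_measure R).
Local Notation f := (beta_density r s).
Local Notation P := (beta_probability r1 s1).
Local Notation F := (rcdf P).

Let B0 : 0 < beta_integral r s. Proof. exact: beta_integral_gt0. Qed.

Lemma beta_probabilityE (A : set (measurableTypeR R)) :
  P A = (\int[mu]_(x in A) ((f \_ `[0%R, 1%R]) x)%:E)%E.
Proof.
rewrite -[LHS]/(beta_measure r s A) beta_measureE.
by apply: eq_integral => x _; rewrite restrict_EFin.
Qed.

Lemma patch_beta_density_ge0 x : 0 <= (f \_ `[0, 1]) x.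
Proof. by rewrite patchE; case: ifPn => // _; exact: beta_density_ge0. Qed.

Lemma beta_density_gt0 u : 0 < u < 1 -> 0 < f u.
Proof. by move=> u01; rewrite divr_gt0// beta_weight_gt0. Qed.

Lemma is_derive_beta_cdf u : 0 < u < 1 -> is_derive u 1 F (f u).
Proof.
move=> u01; have u01' : u \in `[0, 1] by rewrite in_itv/=; lra.
rewrite (_ : f u = (f \_ `[0, 1]) u); last by rewrite patchE mem_set.
apply: is_derive_rcdf.
- have mI : @measurable _ (measurableTypeR R) `[0, 1] by exact: measurable_itv.
  apply: (measurable_restrictT _ mI).1; apply: measurable_funTS.
  exact: measurable_beta_density.
- exact: patch_beta_density_ge0.
- by move=> A _; exact: beta_probabilityE.
- rewrite /prop_for /continuous_at [X in _ --> X]patchE mem_set//.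
  have cf : {for u, continuous f}.
    by apply: cvgM; [exact: continuous_beta_weight|exact: cvg_cst].
  apply: cvg_trans cf; apply: near_eq_cvg; near=> x.
  rewrite patchE mem_set// /=.
  near: x; have : u \in `]0, 1[ by rewrite in_itv.
  by move/near_in_itvoo; apply: filterS => x; exact: subset_itv_oo_cc.
Unshelve. all: by end_near. Qed.

Lemma beta_cdf_lt u v : 0 < u -> v < 1 -> u < v -> F u < F v.
Proof.
move=> u0 v1; apply: (@lt_of_derive_gt0 _ _ f) => z zuv.
  by apply: is_derive_beta_cdf; lra.
by apply: beta_density_gt0; lra.
Qed.

Lemma beta_cdf_itv u : 0 < u < 1 -> 0 < F u < 1.
Proof.
move=> /andP[u0 u1]; apply/andP; split.
  apply: (le_lt_trans (rcdf_ge0 P (u / 2))); apply: beta_cdf_lt; lra.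
apply: lt_le_trans (rcdf_le1 P ((u + 1) / 2)); apply: beta_cdf_lt; lra.
Qed.

(** The density is bounded, hence the distribution function is Lipschitz. *)
Lemma beta_cdf_lipschitz u v : u <= v ->
  F v <= F u + (v - u) / beta_integral r s.
Proof.
move=> uv; rewrite -lee_fin EFinD !EFin_rcdf.
have -> : `]-oo, v]%classic = `]-oo, u]%classic `|` `]u, v]%classic :> set R.
  by rewrite -itv_bndbnd_setU// bnd_simp.
apply: le_trans (measureU2 _ _ _) _; [exact: measurable_itv|exact: measurable_itv|].
apply: leeD => //.
suff: (P `]u, v]%classic <= ((v - u) / beta_integral r s)%:E)%E by [].
rewrite beta_probabilityE.
apply: (@le_trans _ _ (\int[mu]_(x in `]u, v]) ((beta_integral r s)^-1)%:E)%E).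
  apply: ge0_le_integral => //.
  - by move=> x _; rewrite lee_fin patch_beta_density_ge0.
  - apply/measurable_EFinP; apply: measurable_funTS.
    have mI : @measurable _ (measurableTypeR R) `[0, 1] by exact: measurable_itv.
    apply: (measurable_restrictT _ mI).1; apply: measurable_funTS.
    exact: measurable_beta_density.
  - move=> x _; rewrite lee_fin patchE; case: ifPn => [|_].
      rewrite inE/= in_itv/= => /andP[x0 x1].
      rewrite /beta_density ler_piMl ?invr_ge0 ?(ltW B0)// /beta_weight.
      have le1 (y t : R) : 0 <= y <= 1 -> 1 <= t -> y `^ (t - 1) <= 1.
        move=> /andP[y0 y1] t1; rewrite -[leRHS](congr1 (fun f => f (t - 1)) (powR1 R)).
        by apply: ge0_ler_powR; rewrite ?nnegrE ?subr_ge0.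
      by rewrite -[leRHS](mulr1 1) ler_pM ?powR_ge0 ?le1//; lra.
    by rewrite invr_ge0 ltW.
rewrite integral_cst//= lebesgue_measure_itv/=.
case: ifPn => _; last by rewrite mule0 lee_fin divr_ge0 ?subr_ge0// ltW.
by rewrite -EFinB -EFinM mulrC.
Qed.

Lemma beta_probability_le0 : P `]-oo, 0]%classic = 0%E.
Proof.
rewrite -[LHS]/(beta_measure r s `]-oo, 0]%classic) /beta_measure /beta_law.
rewrite (_ : _ `&` _ = [set 0]); first by rewrite integral_set1.
apply/seteqP; split => x /=; rewrite !in_itv/=.
  by move=> [x0 /andP[x1 _]]; apply/eqP; rewrite eq_le x0.
by move=> ->; rewrite lexx ler01.
Qed.

Lemma beta_probability_ge1 : P `[1, +oo[%classic = 0%E.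
Proof.
rewrite -[LHS]/(beta_measure r s `[1, +oo[%classic) /beta_measure /beta_law.
rewrite (_ : _ `&` _ = [set 1]); first by rewrite integral_set1.
apply/seteqP; split => x /=; rewrite !in_itv/=.
  by move=> [/andP[x0 _] /andP[_ x1]]; apply/eqP; rewrite eq_le x0 x1.
by move=> ->; rewrite lexx ler01.
Qed.

Lemma beta_cdf0 : F 0 = 0.
Proof. by apply: EFin_inj; rewrite EFin_rcdf beta_probability_le0. Qed.

Lemma beta_cdf1 : F 1 = 1.
Proof.
have mI1 : @measurable _ (measurableTypeR R) `]-oo, 1] by exact: measurable_itv.
have mI2 : @measurable _ (measurableTypeR R) `]1, +oo[ by exact: measurable_itv.
have N1 : P `]1, +oo[%classic = 0%E.
  apply: (subset_measure0 mI2 _ _ beta_probability_ge1); first exact: measurable_itv.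
  by apply: subset_itvr; rewrite bnd_simp.
apply: EFin_inj; rewrite EFin_rcdf -(probability_setT P).
rewrite -(setUv `]-oo, 1%R]%classic) setCitvl measureU//.
  by rewrite -[RHS]/(P `]-oo, 1%R]%classic + P `]1%R, +oo[%classic)%E N1 adde0.
by rewrite -setCitvl setICr.
Qed.

(** The increasing rearrangement: it preserves the distribution function, and
    so carries the beta law to the standard normal law. *)
Definition transport u : R := gauss_quantile (F u).
Local Notation T := transport.

Lemma gauss_cdf_transport u : 0 < u < 1 -> gauss_cdf (T u) = F u.
Proof. by move=> u01; rewrite gauss_quantileK// beta_cdf_itv. Qed.

Lemma is_derive_transport u : 0 < u < 1 ->
  is_derive u 1 T (f u / gauss_pdf (T u)).
Proof.
move=> u01; rewrite mulrC; apply: is_derive1_comp.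
  by apply: is_derive_gauss_quantile; exact: beta_cdf_itv.
exact: is_derive_beta_cdf.
Qed.

Lemma continuous_transport u : 0 < u < 1 -> {for u, continuous T}.
Proof.
move=> /is_derive_transport[d _].
exact/differentiable_continuous/derivable1_diffP.
Qed.

Lemma transport_lt_near0 M : exists2 d, 0 < d < 1 &
  forall u, 0 < u < d -> T u < M.
Proof.
have /andP[g0 g1] := gauss_cdf_itv M.
exists (Num.min (1 / 2) (gauss_cdf M * beta_integral r s)).
  have h : 0 < gauss_cdf M * beta_integral r s by rewrite mulr_gt0.
  apply/andP; split; first by rewrite lt_min h andbT; lra.
  by rewrite gt_min; apply/orP; left; lra.
move=> u /andP[u0]; rewrite lt_min => /andP[u2 ug].
have u01 : 0 < u < 1 by lra.
rewrite -(leW_mono (@gauss_cdf_le_mono R)) gauss_cdf_transport//.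
have := beta_cdf_lipschitz (ltW u0); rewrite beta_cdf0 add0r subr0 => /le_lt_trans; apply.
by rewrite ltr_pdivrMr.
Qed.

Lemma transport_gt_near1 M : exists2 d, 0 < d < 1 &
  forall u, d < u < 1 -> M < T u.
Proof.
have /andP[g0 g1] := gauss_cdf_itv M.
exists (Num.max (1 / 2) (1 - (1 - gauss_cdf M) * beta_integral r s)).
  have h : 0 < (1 - gauss_cdf M) * beta_integral r s by rewrite mulr_gt0 ?subr_gt0.
  apply/andP; split; first by rewrite lt_max; apply/orP; left; lra.
  by rewrite gt_max ltrBlDr ltrDl h andbT; lra.
move=> u /andP[]; rewrite gt_max => /andP[u2 ug] u1.
have u01 : 0 < u < 1 by lra.
rewrite -(leW_mono (@gauss_cdf_le_mono R)) gauss_cdf_transport//.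
have := beta_cdf_lipschitz (ltW u1); rewrite beta_cdf1 -lerBlDr => h.
apply: lt_le_trans h; rewrite ltrBrDl -ltrBrDr ltr_pdivrMr//.
by rewrite ltrBlDl -ltrBlDr.
Qed.

(** At both ends [T] is infinite, where the normal density beats any linear
    function of [T]. *)
Lemma cvg0_gauss_bound (c : R) (g : R -> R) : 0 <= c ->
  (forall u, 0 < u < 1 -> `|g u| <= (`|T u| + c) * gauss_pdf (T u)) ->
  g u @[u --> 0^'+] --> (0 : R) /\ g u @[u --> 1^'-] --> (0 : R).
Proof.
move=> c0 gT; split; apply/cvgrPdist_le => e e0.
- have [M M0 HM] := gauss_pdf_decay c0 e0.
  have [d /andP[d0 d1] Hd] := transport_lt_near0 (- M).
  near=> u; rewrite sub0r normrN; have u0 : 0 < u by near: u; exact: nbhs_right_gt.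
  have ud : u < d by near: u; exact: nbhs_right_lt.
  apply: (le_trans (gT u _)); first by rewrite u0 (lt_trans ud).
  apply: HM; rewrite -normrN (le_trans _ (ler_norm _))// lerNr ltW//.
  by rewrite Hd// u0.
- have [M M0 HM] := gauss_pdf_decay c0 e0.
  have [d /andP[d0 d1] Hd] := transport_gt_near1 M.
  near=> u; rewrite sub0r normrN; have u1 : u < 1 by near: u; exact: nbhs_left_lt.
  have ud : d < u by near: u; exact: nbhs_left_gt.
  apply: (le_trans (gT u _)); first by rewrite u1 (lt_trans d0).
  by apply: HM; rewrite (le_trans _ (ler_norm _))// ltW// Hd// ud.
Unshelve. all: by end_near. Qed.

End beta_transport.

(** * Second moment and tails of the monotone map *)

Section beta_transport_bounds.
Variables (R : realType) (r s : R) (r1 : 1 <= r) (s1 : 1 <= s).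
Implicit Types u v x : R.
Local Notation mu := (@lebesgue_measure R).
Local Notation f := (beta_density r s).
Local Notation P := (beta_probability r1 s1).
Local Notation F := (rcdf P).
Local Notation T := (transport r1 s1).

Let B0 : 0 < beta_integral r s. Proof. exact: beta_integral_gt0. Qed.

Lemma is_derive_gauss_pdf_transport u : 0 < u < 1 ->
  is_derive u 1 (gauss_pdf \o T) (- T u * f u).
Proof.
move=> u01; have /= d := is_derive1_comp (is_derive_gauss_pdf (T u))
  (is_derive_transport r1 s1 u01).
apply: is_derive_eq.
by field; rewrite gt_eqF// gauss_pdf_gt0.
Qed.

Lemma continuous_beta_density u : 0 < u < 1 -> {for u, continuous f}.
Proof.
by move=> u01; apply: cvgM; [exact: continuous_beta_weight|exact: cvg_cst].
Qed.

Lemma integral_beta_density : (\int[mu]_(u in `]0%R, 1%R[) (f u)%:E = 1)%E.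
Proof.
have <- : (\int[P]_u cst 1 u = 1)%E.
  by rewrite integral_cst// mul1e; exact: probability_setT.
rewrite integral_beta_probability//.
by apply: eq_integral => u _; rewrite mul1e.
Qed.

(** The derivative of [T * gauss_pdf T] is [f - f * T ^ 2], so [T ^ 2] has
    mean 1. *)
Lemma integral_transport_sqr :
  (\int[mu]_(u in `]0%R, 1%R[) (f u * T u ^+ 2)%:E = 1)%E.
Proof.
rewrite -integral_beta_density; apply/esym.
pose G u := T u * (gauss_pdf \o T) u.
have [G0 G1] : G u @[u --> 0^'+] --> (0 : R) /\ G u @[u --> 1^'-] --> (0 : R).
  apply: (@cvg0_gauss_bound _ _ _ r1 s1 0) => // u u01.
  by rewrite addr0 normrM ler_wpM2l// ger0_norm// ltW// gauss_pdf_gt0.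
apply: (@integral_eq_of_derive R G) G0 G1 => u u01.
- have /= d := is_deriveM (is_derive_transport r1 s1 u01)
    (is_derive_gauss_pdf_transport u01).
  apply: is_derive_eq.
  by rewrite /GRing.scale/=; field; rewrite gt_eqF// gauss_pdf_gt0.
- exact: continuous_beta_density.
- apply: cvgM; first exact: continuous_beta_density.
  by apply: cvgr_exprn; exact: continuous_transport.
- exact: beta_density_ge0.
- by rewrite mulr_ge0 ?beta_density_ge0// sqr_ge0.
Qed.

Lemma le_transport u v : 0 < u -> v < 1 -> u <= v -> T u <= T v.
Proof.
move=> u0 v1 uv; rewrite -gauss_cdf_le_mono !gauss_cdf_transport ?le_rcdf//; lra.
Qed.

(** Markov's inequality for [T ^ 2], whose mean is 1. *)
Lemma transport_markov (A : set (measurableTypeR R)) (k : R) :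
  measurable A -> 0 <= k ->
  (forall u, 0 < u < 1 -> A u -> k <= T u ^+ 2) -> (k%:E * P A <= 1)%E.
Proof.
move=> mA k0 kT.
have mI : measurable_fun [set: measurableTypeR R] (fun u => (\1_A u : R)%:E).
  exact/measurable_EFinP/measurable_indic.
have -> : (k%:E * P A = \int[P]_u (k%:E * (\1_A u)%:E))%E.
  by rewrite (ge0_integralZl _ _ mI)// integral_indic// setIT.
rewrite integral_beta_probability//; last 2 first.
- exact: measurable_funeM.
- by move=> x; rewrite mule_ge0.
rewrite -integral_transport_sqr; apply: ge0_le_integral => //.
- by move=> u _; rewrite !mule_ge0// lee_fin beta_density_ge0.
- apply: emeasurable_funM.
    by apply: measurable_funTS; exact: measurable_funeM.
  by apply/measurable_EFinP; apply: measurable_funTS; exact: measurable_beta_density.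
- apply/measurable_EFinP; apply: measurable_fun_oo => u u01.
  apply: cvgM; first exact: continuous_beta_density.
  by apply: cvgr_exprn; exact: continuous_transport.
- move=> u; rewrite /= in_itv/= => u01; rewrite -!EFinM lee_fin mulrC.
  rewrite ler_wpM2l ?beta_density_ge0// indicE.
  have [uA|uA] := boolP (u \in A); last by rewrite mulr0 sqr_ge0.
  by rewrite mulr1 kT//; rewrite inE in uA.
Qed.

(** If [T u <= 0], then [T ^ 2] is at least [T u ^ 2] to the left of [u]. *)
Lemma transport_sqr_le_cdf u : 0 < u < 1 -> T u <= 0 -> T u ^+ 2 * F u <= 1.
Proof.
move=> u01 Tu; rewrite -lee_fin EFinM EFin_rcdf.
apply: transport_markov; [exact: measurable_itv|exact: sqr_ge0|].
move=> x x01; rewrite /= in_itv/= => xu.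
have xT : T x <= T u by apply: le_transport => //; lra.
by rewrite -[leLHS]sqrrN -[leRHS]sqrrN ler_pXn2r// ?nnegrE; lra.
Qed.

Lemma transport_sqr_le_ccdf u : 0 < u < 1 -> 0 <= T u ->
  T u ^+ 2 * (1 - F u) <= 1.
Proof.
move=> u01 Tu; rewrite -lee_fin EFinM EFinB EFin_rcdf.
rewrite -(probability_setC P); last exact: measurable_itv.
apply: transport_markov; [|exact: sqr_ge0|].
  by apply: measurableC; exact: measurable_itv.
move=> x x01; rewrite /= in_itv/= => /negP; rewrite -ltNge => ux.
have xT : T u <= T x by apply: le_transport => //; lra.
by rewrite ler_pXn2r// ?nnegrE; lra.
Qed.

End beta_transport_bounds.

(** * The monotone map against the beta density *)

Lemma beta_weightM (R : realType) (r s r' s' x : R) : 0 < x < 1 ->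
  beta_weight r s x * beta_weight r' s' x =
  beta_weight (r + r' - 1) (s + s' - 1) x.
Proof.
move=> /andP[x0 x1]; have y0 : 0 < 1 - x by rewrite subr_gt0.
rewrite /beta_weight mulrACA -!powRD ?(gt_eqF x0) ?(gt_eqF y0) ?implybT//.
by congr (_ `^ _ * _ `^ _); lra.
Qed.

Section beta_density_tail.
Variables (R : realType) (r s : R) (r1 : 1 <= r) (s1 : 1 <= s).
Hypotheses (r3 : 3 <= r) (s3 : 3 <= s).
Implicit Types u v x : R.
Local Notation B := (beta_integral r s).
Local Notation f := (beta_density r s).
Local Notation P := (beta_probability r1 s1).
Local Notation F := (rcdf P).
Local Notation T := (transport r1 s1).

Let B0 : 0 < B. Proof. exact: beta_integral_gt0. Qed.

(** The squared density divided by [u * (1 - u)], a beta weight again. *)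
Let q u := beta_weight (2 * r - 2) (2 * s - 2) u / B ^+ 2.
Let K := 2 * (r + s) / B.
Let dq u := q u * ((2 * r - 3) / u - (2 * s - 3) / (1 - u)).

Let K0 : 0 < K.
Proof. by rewrite divr_gt0// mulr_gt0//; have := r3; have := s3; lra. Qed.

Let qE u : 0 < u < 1 -> f u ^+ 2 = q u * (u * (1 - u)).
Proof.
move=> u01; rewrite /f /q /beta_density exprMn expr2 beta_weightM//.
rewrite (_ : r + r - 1 = 2 * r - 2 + 1); last ring.
rewrite (_ : s + s - 1 = 2 * s - 2 + 1); last ring.
by rewrite beta_weightSl// beta_weightSr// exprVn; ring.
Qed.

Let is_derive_q u : 0 < u < 1 -> is_derive u 1 q (dq u).
Proof.
move=> u01.
have /= d := is_deriveM (is_derive_beta_weight (2 * r - 2) (2 * s - 2) u01)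
  (is_derive_cst ((B ^+ 2)^-1) u (1 : R)).
apply: is_derive_eq; rewrite /GRing.scale/= /dq /q.
rewrite (_ : 2 * r - 2 - 1 = 2 * r - 3); last ring.
rewrite (_ : 2 * s - 2 - 1 = 2 * s - 3); last ring.
ring.
Qed.

Let norm_dq u : 0 < u < 1 -> `|dq u| <= K * f u.
Proof.
move=> u01; have /andP[u0 u1] := u01; have y0 : 0 < 1 - u by rewrite subr_gt0.
have f0 := beta_density_gt0 r1 s1 u01.
pose g := f u / B.
have g0 : 0 <= g by rewrite divr_ge0// ltW.
have E1 : q u * ((2 * r - 3) / u) = (2 * r - 3) * beta_weight (r - 2) (s - 1) u * g.
  rewrite /q /g /f /beta_density.
  rewrite (_ : 2 * r - 2 = r + (r - 2) - 1 + 1); last ring.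
  rewrite (_ : 2 * s - 2 = s + (s - 1) - 1); last ring.
  rewrite beta_weightSl// -beta_weightM//.
  by field; rewrite !gt_eqF.
have E2 : q u * ((2 * s - 3) / (1 - u)) = (2 * s - 3) * beta_weight (r - 1) (s - 2) u * g.
  rewrite /q /g /f /beta_density.
  rewrite (_ : 2 * r - 2 = r + (r - 1) - 1); last ring.
  rewrite (_ : 2 * s - 2 = s + (s - 2) - 1 + 1); last ring.
  rewrite beta_weightSr// -beta_weightM//.
  by field; rewrite !gt_eqF.
rewrite /dq mulrBr E1 E2 -mulrBl normrM (ger0_norm g0).
rewrite (_ : K * f u = 2 * (r + s) * g); last by rewrite /K /g; ring.
rewrite ler_wpM2r//.
have w1 : 0 < beta_weight (r - 2) (s - 1) u <= 1.
  by rewrite beta_weight_gt0// beta_weight_le1//; have := r3; have := s3; lra.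
have w2 : 0 < beta_weight (r - 1) (s - 2) u <= 1.
  by rewrite beta_weight_gt0// beta_weight_le1//; have := r3; have := s3; lra.
move: w1 w2; set w1 := beta_weight _ _ _; set w2 := beta_weight _ _ _.
move=> /andP[a1 a2] /andP[b1 b2]; have := r3; have := s3 => s3' r3'.
clear E1 E2 f0.
by rewrite ler_norml; apply/andP; split; nra.
Qed.

Let q_le u : 0 < u < 1 -> q u <= u / B ^+ 2 /\ q u <= (1 - u) / B ^+ 2.
Proof.
move=> u01; have /andP[u0 u1] := u01.
have l1 : 1 <= 2 * r - 3 by have := r3; lra.
have l2 : 1 <= 2 * s - 3 by have := s3; lra.
have l3 : 1 <= 2 * r - 2 by have := r3; lra.
have l4 : 1 <= 2 * s - 2 by have := s3; lra.
split; rewrite /q ler_wpM2r ?invr_ge0 ?sqr_ge0//.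
- rewrite (_ : 2 * r - 2 = 2 * r - 3 + 1); last ring.
  by rewrite beta_weightSl// ler_piMr ?(ltW u0)// beta_weight_le1.
- rewrite (_ : 2 * s - 2 = 2 * s - 3 + 1); last ring.
  by rewrite beta_weightSr// ler_piMr ?subr_ge0 ?(ltW u1)// beta_weight_le1.
Qed.

(** [K * F - q] is nondecreasing by the bound on the derivative of [q], and
    [q] tends to 0 at 0. *)
Let q_le_cdf u : 0 < u < 1 -> q u <= K * F u.
Proof.
move=> /andP[u0 u1]; apply/ler_addgt0Pr => e e0.
pose v := Num.min (u / 2) (e * B ^+ 2).
have v0 : 0 < v by rewrite lt_min !mulr_gt0 ?exprn_gt0.
have vu : v <= u / 2 by rewrite ge_min lexx.
have vu' : v < u by lra.
have ve : v / B ^+ 2 <= e by rewrite ler_pdivrMr ?exprn_gt0// ge_min lexx orbT.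
have [qv _] : q v <= v / B ^+ 2 /\ q v <= (1 - v) / B ^+ 2 by apply: q_le; lra.
have : K * F v - q v <= K * F u - q u.
  apply: (@le_of_derive_ge0 _ (fun x => K * F x - q x) (fun x => K * f x - dq x)).
  - move=> z zuv; have z01 : 0 < z < 1 by lra.
    have d1 := is_deriveZ K (is_derive_beta_cdf r1 s1 z01).
    have := is_deriveB d1 (is_derive_q z01) => d.
    exact: d.
  - move=> z zuv; have z01 : 0 < z < 1 by lra.
    by rewrite subr_ge0 (le_trans (ler_norm _)) ?norm_dq.
  - exact: ltW.
have : 0 <= K * F v by rewrite mulr_ge0 ?rcdf_ge0 ?(ltW K0).
set x1 := K * F v; set x2 := K * F u; move: qv ve; set w := v / _; lra.
Qed.

(** Likewise [K * (F - 1) + q] is nondecreasing, and [q] tends to 0 at 1. *)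
Let q_le_ccdf u : 0 < u < 1 -> q u <= K * (1 - F u).
Proof.
move=> /andP[u0 u1]; apply/ler_addgt0Pr => e e0.
pose v := 1 - Num.min ((1 - u) / 2) (e * B ^+ 2).
have v1 : v < 1.
  by rewrite ltrBlDr ltrDl lt_min !mulr_gt0 ?exprn_gt0 ?subr_gt0.
have vu : Num.min ((1 - u) / 2) (e * B ^+ 2) <= (1 - u) / 2 by rewrite ge_min lexx.
have vu' : u < v by rewrite /v; lra.
have ve : (1 - v) / B ^+ 2 <= e.
  by rewrite ler_pdivrMr ?exprn_gt0// /v opprB addrC subrK ge_min lexx orbT.
have [_ qv] : q v <= v / B ^+ 2 /\ q v <= (1 - v) / B ^+ 2 by apply: q_le; lra.
have : K * F u + q u <= K * F v + q v.
  apply: (@le_of_derive_ge0 _ (fun x => K * F x + q x) (fun x => K * f x + dq x)).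
  - move=> z zuv; have z01 : 0 < z < 1 by lra.
    have d1 := is_deriveZ K (is_derive_beta_cdf r1 s1 z01).
    have := is_deriveD d1 (is_derive_q z01) => d.
    exact: d.
  - move=> z zuv; have z01 : 0 < z < 1 by lra.
    by rewrite -[dq z]opprK subr_ge0 (le_trans (ler_norm _))// normrN norm_dq.
  - exact: ltW.
have : 0 <= K * (1 - F v) by rewrite mulr_ge0 ?subr_ge0 ?rcdf_le1 ?(ltW K0).
rewrite !mulrBr mulr1.
set x1 := K * F v; set x2 := K * F u; move: qv ve; set w := _ / _; lra.
Qed.

(** By Markov's inequality [T ^ 2] is at most the inverse of one of the two
    tails of the beta law, and [f ^ 2] is at most a multiple of [u * (1 - u)]
    times either tail. Hence [T * f] vanishes at the end points although [T] is
    unbounded there. *)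
Lemma norm_transport_density u : 0 < u < 1 ->
  `|T u * f u| <= (1 + K) * beta_weight (3 / 2) (3 / 2) u.
Proof.
move=> u01; have /andP[u0 u1] := u01.
have w0 := beta_weight_gt0 (3 / 2) (3 / 2) u01.
have w2 : beta_weight (3 / 2) (3 / 2) u ^+ 2 = u * (1 - u).
  rewrite expr2 beta_weightM// (_ : 3 / 2 + 3 / 2 - 1 = 1 + 1); last by field.
  by rewrite beta_weightSl// beta_weightSr// /beta_weight subrr !powRr0; ring.
have sq : (T u * f u) ^+ 2 <= K * (u * (1 - u)).
  rewrite exprMn qE// [leLHS]mulrA ler_wpM2r ?mulr_ge0 ?subr_ge0 ?(ltW u0) ?(ltW u1)//.
  have /orP[T0|T0] := le_total 0 (T u).
    apply: (le_trans (ler_wpM2l (sqr_ge0 _) (q_le_ccdf u01))).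
    by rewrite mulrCA ler_piMr ?(ltW K0)// transport_sqr_le_ccdf.
  apply: (le_trans (ler_wpM2l (sqr_ge0 _) (q_le_cdf u01))).
  by rewrite mulrCA ler_piMr ?(ltW K0)// transport_sqr_le_cdf// ltW.
rewrite -(ler_pXn2r (ltn0Sn 1)) ?nnegrE ?normr_ge0//; last first.
  by rewrite mulr_ge0 ?(ltW w0)// addr_ge0// ltW.
rewrite -normrX ger0_norm ?sqr_ge0// [leRHS]exprMn w2 (le_trans sq)//.
rewrite ler_wpM2r ?mulr_ge0 ?subr_ge0 ?(ltW u0) ?(ltW u1)//.
by have := K0; nra.
Qed.

End beta_density_tail.

(** * Transport error and score *)

Section transport_estimate.
Variables (R : realType) (a b c m : R) (a1 : 1 <= a) (b1 : 1 <= b).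
Hypotheses (a3 : 3 <= a) (b3 : 3 <= b) (c0 : 0 < c) (m01 : 0 <= m <= 1).
Implicit Types u : R.
Local Notation mu := (@lebesgue_measure R).
Local Notation f := (beta_density a b).
Local Notation T := (transport a1 b1).
Local Notation phi u := (gauss_pdf (T u)).

Let D u := c * T u - (Num.sqrt u - m).

(** In the coordinate [y = Num.sqrt u] the beta law has density
    [2 * Num.sqrt u * f u], whose negative logarithm has the derivative
    [- (2 * Num.sqrt u * f u)' / f u]. The defect is [c ^ 2] times the difference
    between this score and the score [(y - m) / c ^ 2] of the normal law of mean
    [m] and variance [c ^ 2]. *)
Definition score_defect u :=
  - 2 * c ^+ 2 * Num.sqrt u * ((a - 1 / 2) / u - (b - 1) / (1 - u))
  - (Num.sqrt u - m).
Local Notation S := score_defect.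

(** The first term of [A] is [c ^ 2 * f * (x + 1 / x - 2)], where [x] is the
    quotient of the derivatives of [c * T] and [Num.sqrt]; its sign expresses
    that both maps are increasing. *)
Let G u := D u * (2 * c ^+ 2 * Num.sqrt u * f u - c * phi u).
Let A u := c * (2 * c * Num.sqrt u * f u - phi u) ^+ 2 / (2 * Num.sqrt u * phi u)
  + f u * (D u - S u / 2) ^+ 2.
Let B u := f u * S u ^+ 2 / 4.

Let is_derive_D u : 0 < u < 1 ->
  is_derive u 1 D (c * (f u / phi u) - (2 * Num.sqrt u)^-1).
Proof.
move=> u01; have /andP[u0 u1] := u01.
have d1 := is_deriveZ c (is_derive_transport a1 b1 u01).
have d2 := is_deriveB (is_derive1_sqrt u0) (is_derive_cst m u (1:R)).
have d := is_deriveB d1 d2.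
by apply: is_derive_eq; rewrite /GRing.scale/= subr0.
Qed.

Let is_derive_G u : 0 < u < 1 -> is_derive u 1 G (A u - B u).
Proof.
move=> u01; have /andP[u0 u1] := u01; have y0 : 0 < 1 - u by rewrite subr_gt0.
have df : is_derive u 1 f (f u * ((a - 1) / u - (b - 1) / (1 - u))).
  have d := is_deriveM (is_derive_beta_weight a b u01)
    (is_derive_cst ((beta_integral a b)^-1) u (1 : R)).
  apply: is_derive_eq; rewrite /GRing.scale/= /beta_density.
  ring.
have dH : is_derive u 1 (fun u => 2 * c ^+ 2 * Num.sqrt u * f u - c * phi u)
   (2 * c ^+ 2 * ((2 * Num.sqrt u)^-1 * f u + Num.sqrt u * (f u * ((a - 1) / u - (b - 1) / (1 - u))))
    - c * (- T u * f u)).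
  have d1 := is_deriveM (is_deriveZ (2 * c ^+ 2) (is_derive1_sqrt u0)) df.
  have d2 := is_deriveZ c (is_derive_gauss_pdf_transport a1 b1 u01).
  have d := is_deriveB d1 d2.
  by apply: is_derive_eq; rewrite /GRing.scale/= /GRing.scale/=; ring.
have d := is_deriveM (is_derive_D u01) dH.
apply: is_derive_eq; rewrite /GRing.scale/= /A /B /S.
have ph := gauss_pdf_gt0 (T u).
have y1 : 0 < Num.sqrt u by rewrite sqrtr_gt0.
have uE : u = Num.sqrt u ^+ 2 by rewrite sqr_sqrtr// ltW.
rewrite /D; move: y0 ph y1 uE; move: (T u) (f u) (gauss_pdf _) (Num.sqrt u) => t h g y y0 g0 yp uE.
rewrite uE in y0 *.
by field; rewrite !gt_eqF.
Qed.

Let continuous_phi u : 0 < u < 1 -> {for u, continuous (fun u => phi u)}.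
Proof.
move=> /(is_derive_gauss_pdf_transport a1 b1)[d _].
exact/differentiable_continuous/derivable1_diffP.
Qed.

Let continuous_D u : 0 < u < 1 -> {for u, continuous D}.
Proof.
by move=> /is_derive_D[d _]; exact/differentiable_continuous/derivable1_diffP.
Qed.

Lemma continuous_score_defect u : 0 < u < 1 -> {for u, continuous S}.
Proof.
move=> /andP[u0 u1]; have y0 : 0 < 1 - u by rewrite subr_gt0.
apply: cvgB; last by apply: cvgB; [exact: sqrt_continuous|exact: cvg_cst].
apply: cvgM; first by apply: cvgM; [exact: cvg_cst|exact: sqrt_continuous].
apply: cvgB; apply: cvgM; try exact: cvg_cst.
- by apply: cvgV; [rewrite gt_eqF|exact: cvg_id].
- apply: cvgV; first by rewrite gt_eqF.
  by apply: cvgB; [exact: cvg_cst|exact: cvg_id].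
Qed.

Let continuous_A u : 0 < u < 1 -> {for u, continuous A}.
Proof.
move=> u01; have /andP[u0 u1] := u01.
have ph := gauss_pdf_gt0 (T u).
have y1 : 0 < Num.sqrt u by rewrite sqrtr_gt0.
apply: cvgD.
- apply: cvgM.
    apply: cvgM; first exact: cvg_cst.
    apply: cvgr_exprn; apply: cvgB; last exact: continuous_phi.
    apply: cvgM; last exact: continuous_beta_density.
    by apply: cvgM; [exact: cvg_cst|exact: sqrt_continuous].
  apply: cvgV; first by rewrite gt_eqF// !mulr_gt0.
  apply: cvgM; last exact: continuous_phi.
  by apply: cvgM; [exact: cvg_cst|exact: sqrt_continuous].
- apply: cvgM; first exact: continuous_beta_density.
  apply: cvgr_exprn; apply: cvgB; first exact: continuous_D.
  by apply: cvgM; [exact: continuous_score_defect|exact: cvg_cst].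
Qed.

Let continuous_B u : 0 < u < 1 -> {for u, continuous B}.
Proof.
move=> u01; apply: cvgM; last exact: cvg_cst.
apply: cvgM; first exact: continuous_beta_density.
by apply: cvgr_exprn; exact: continuous_score_defect.
Qed.

Let sqrt_itv u : 0 < u < 1 -> 0 < Num.sqrt u <= 1.
Proof.
move=> /andP[u0 u1]; rewrite sqrtr_gt0 u0/= -[leRHS]sqrtr1.
by rewrite ler_sqrt// ltW.
Qed.

Let G_cvg0 : G u @[u --> 0^'+] --> (0 : R) /\ G u @[u --> 1^'-] --> (0 : R).
Proof.
have /andP[m0 m1] := m01.
pose g1 u := 2 * c ^+ 3 * (Num.sqrt u * (T u * f u)).
pose g2 u := 2 * c ^+ 2 * (Num.sqrt u * (m - Num.sqrt u) * f u).
pose g3 u := - c ^+ 2 * ((D u / c) * phi u).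
(* each summand is controlled by one of the two end point estimates *)
have GE u : G u = g1 u + g2 u + g3 u.
  by rewrite /G /g1 /g2 /g3 /D; field; rewrite gt_eqF.
have [g10 g11] : g1 u @[u --> 0^'+] --> (0 : R) /\ g1 u @[u --> 1^'-] --> (0 : R).
  apply: (@cvg0_beta_weight_bound _ (3 / 2) (3 / 2)
    (2 * c ^+ 3 * (1 + 2 * (a + b) / beta_integral a b))); [lra|lra|] => u u01.
  rewrite normrM ger0_norm ?mulr_ge0 ?exprn_ge0 ?(ltW c0)// -[leRHS]mulrA.
  rewrite ler_wpM2l ?mulr_ge0 ?exprn_ge0 ?(ltW c0)//.
  apply: (le_trans _ (norm_transport_density a1 b1 a3 b3 u01)).
  have /andP[y0 y1] := sqrt_itv u01.
  by rewrite normrM ler_piMl// ger0_norm// ltW.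
have [g20 g21] : g2 u @[u --> 0^'+] --> (0 : R) /\ g2 u @[u --> 1^'-] --> (0 : R).
  apply: (@cvg0_beta_weight_bound _ a b (2 * c ^+ 2 / beta_integral a b)).
  - by have := a3; lra.
  - by have := b3; lra.
  move=> u u01; have /andP[y0 y1] := sqrt_itv u01.
  rewrite normrM ger0_norm ?mulr_ge0 ?exprn_ge0 ?(ltW c0)// -[leRHS]mulrA.
  rewrite ler_wpM2l ?mulr_ge0 ?exprn_ge0 ?(ltW c0)//.
  rewrite normrM [X in _ * X <= _]ger0_norm; last exact: beta_density_ge0.
  rewrite [leRHS]mulrC ler_piMl ?beta_density_ge0//.
  by rewrite ler_norml; apply/andP; split; nra.
have [g30 g31] : g3 u @[u --> 0^'+] --> (0 : R) /\ g3 u @[u --> 1^'-] --> (0 : R).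
  have [h0 h1] : D u / c * phi u @[u --> 0^'+] --> (0 : R) /\
      D u / c * phi u @[u --> 1^'-] --> (0 : R).
    apply: (@cvg0_gauss_bound _ _ _ a1 b1 c^-1) => [|u u01].
      by rewrite invr_ge0 ltW.
    rewrite normrM [X in _ * X <= _]ger0_norm; last exact/ltW/gauss_pdf_gt0.
    rewrite ler_wpM2r ?(ltW (gauss_pdf_gt0 _))//.
    rewrite (_ : D u / c = T u - (Num.sqrt u - m) / c); last first.
      by rewrite /D; field; rewrite gt_eqF.
    rewrite (le_trans (ler_normB _ _))// lerD2l normrM normfV (gtr0_norm c0).
    rewrite ler_piMl ?invr_ge0 ?(ltW c0)//.
    by have /andP[y0 y1] := sqrt_itv u01; rewrite ler_norml; lra.
  by split; rewrite /g3 -[X in _ --> X](mulr0 (- c ^+ 2)); apply: cvgM => //; exact: cvg_cst.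
have Z : (0 : R) = 0 + 0 + 0 by rewrite !addr0.
by rewrite (funext GE); split; rewrite [X in _ --> X]Z; do 2 apply: cvgD => //.
Qed.

(** A one-dimensional transport inequality: the mean square distance between
    [Num.sqrt u - m] and [c * T u] is at most that of the scores. As [G] vanishes
    at both ends, its derivative [A - B] has integral 0; so [D - S / 2] is at most
    [S / 2] in mean square, and [D ^ 2 <= 2 * (D - S / 2) ^ 2 + S ^ 2 / 2]. *)
Lemma transport_score_estimate :
  (\int[mu]_(u in `]0%R, 1%R[) (f u * (c * T u - (Num.sqrt u - m)) ^+ 2)%:E <=
   \int[mu]_(u in `]0%R, 1%R[) (f u * S u ^+ 2)%:E)%E.
Proof.
have [G0 G1] := G_cvg0.
have pos u : 0 < u < 1 -> [/\ 0 < f u, 0 < Num.sqrt u & 0 < phi u].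
  move=> u01; have /andP[y0 _] := sqrt_itv u01.
  by split => //; [exact: beta_density_gt0|exact: gauss_pdf_gt0].
have A1 u : 0 < u < 1 -> f u * (D u - S u / 2) ^+ 2 <= A u.
  move=> /pos[f0 y0 p0]; rewrite /A lerDr divr_ge0//.
    by rewrite mulr_ge0 ?sqr_ge0// ltW.
  by rewrite !mulr_ge0// ltW.
have A0 u : 0 < u < 1 -> 0 <= A u.
  move=> u01; apply: le_trans (A1 u u01); have [f0 _ _] := pos u u01.
  by rewrite mulr_ge0 ?sqr_ge0// ltW.
have B0 u : 0 < u < 1 -> 0 <= B u.
  by move=> /pos[f0 _ _]; rewrite /B divr_ge0// mulr_ge0 ?sqr_ge0// ltW.
have AB := integral_eq_of_derive is_derive_G continuous_A continuous_B A0 B0 G0 G1.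
have mA : measurable_fun (`]0, 1[ : set (measurableTypeR R)) (EFin \o A).
  by apply/measurable_EFinP; apply: measurable_fun_oo; exact: continuous_A.
have mB : measurable_fun (`]0, 1[ : set (measurableTypeR R)) (EFin \o B).
  by apply/measurable_EFinP; apply: measurable_fun_oo; exact: continuous_B.
have mC : measurable_fun (`]0, 1[ : set (measurableTypeR R))
    (fun u => (2 * A u + 2 * B u)%:E).
  apply/measurable_EFinP; apply: measurable_fun_oo => u u01.
  apply: cvgD; (apply: cvgM; first exact: cvg_cst).
    exact: continuous_A.
  exact: continuous_B.
apply: (@le_trans _ _ (\int[mu]_(u in `]0%R, 1%R[) (2 * A u + 2 * B u)%:E)%E).
  apply: ge0_le_integral => //.
  - move=> u; rewrite /= in_itv/= => /pos[f0 _ _].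
    by rewrite lee_fin mulr_ge0 ?sqr_ge0// ltW.
  - apply/measurable_EFinP; apply: measurable_fun_oo => u u01.
    apply: cvgM; first exact: continuous_beta_density.
    by apply: cvgr_exprn; exact: continuous_D.
  - move=> u; rewrite /= in_itv/= => u01; rewrite lee_fin -/(D u).
    apply: (@le_trans _ _ (2 * (f u * (D u - S u / 2) ^+ 2) + 2 * B u)); last first.
      by rewrite lerD2r ler_wpM2l// A1.
    have [f0 _ _] := pos u u01.
    rewrite (_ : _ + _ = f u * (2 * (D u - S u / 2) ^+ 2 + S u ^+ 2 / 2)); last first.
      by rewrite /B; field.
    rewrite ler_wpM2l ?(ltW f0)//.
    by have := sqr_ge0 (D u - S u); rewrite !expr2; lra.
under eq_integral do rewrite EFinD !EFinM.
rewrite ge0_integralD//; last 4 first.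
- by move=> u; rewrite /= in_itv/= => u01; rewrite -EFinM lee_fin mulr_ge0// A0.
- exact: measurable_funeM.
- by move=> u; rewrite /= in_itv/= => u01; rewrite -EFinM lee_fin mulr_ge0// B0.
- exact: measurable_funeM.
have iA0 u : `]0%R, 1%R[%classic u -> (0 <= (A u)%:E)%E.
  by rewrite /= in_itv/= => u01; rewrite lee_fin A0.
have iB0 u : `]0%R, 1%R[%classic u -> (0 <= (B u)%:E)%E.
  by rewrite /= in_itv/= => u01; rewrite lee_fin B0.
have itv01 : @measurable _ (measurableTypeR R) `]0, 1[ by exact: measurable_itv.
rewrite (ge0_integralZl mu itv01 mA iA0)// (ge0_integralZl mu itv01 mB iB0)//.
rewrite AB -ge0_muleDl// -EFinD -(ge0_integralZl mu itv01 mB iB0)//.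
rewrite le_eqVlt; apply/orP; left; apply/eqP; apply: eq_integral => u _.
by rewrite -EFinM /B; congr EFin; field.
Qed.

End transport_estimate.

(** * The coupling *)

(** Half-open bounded intervals are stable under intersection and generate the
    Borel sets. *)
Lemma probability_eq_rcdf (R : realType)
    (P Q : probability (measurableTypeR R) R) :
  (forall x, rcdf P x = rcdf Q x) -> forall A, measurable A -> P A = Q A.
Proof.
move=> PQ A mA.
have mI (i : interval R) : @measurable _ (measurableTypeR R) [set` i].
  exact: measurable_itv.
have PQNy x : P `]-oo, x]%classic = Q `]-oo, x]%classic.
  by rewrite -!EFin_rcdf PQ.
have EP (M : probability (measurableTypeR R) R) a b : a <= b ->
    M `]a, b]%classic = (M `]-oo, b]%classic - M `]-oo, a]%classic)%E.
  move=> ab; have -> : `]a, b]%classic = `]-oo, b] `\` `]-oo, a] :> set R.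
    by rewrite -[RHS]setCK setCD setCitvl setUC -[LHS]setCK setCitv.
  rewrite (measureD (mI _) (mI _)).
    by rewrite setIidr//; apply: subset_itvl.
  by apply: le_lt_trans (probability_le1 M (mI _)) _; rewrite ltry.
apply: (@measure_unique _ R (measurableTypeR R) (@ocitv R)
  (fun k => `]- k%:R, k%:R]%classic)) => //.
- exact: ocitvI.
- by move=> k; exact: is_ocitv.
- apply/seteqP; split => // x _; exists (Num.truncn `|x|).+1 => //=.
  have := truncnS_gt `|x|; rewrite ltr_norml in_itv/= => /andP[-> /ltW].
  by [].
- move=> B [[a b] _ <-] /=; have [ab|ba] := leP a b.
    by rewrite (EP P)// (EP Q)// !PQNy.
  by rewrite set_itv_ge ?measure0// bnd_simp -leNgt ltW.
- by move=> k; apply: le_lt_trans (probability_le1 P (mI _)) _; rewrite ltry.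
Qed.

Lemma measurable_sqrt (R : realType) :
  measurable_fun [set: measurableTypeR R] (@Num.sqrt R).
Proof. by apply: continuous_measurable_fun; exact: sqrt_continuous. Qed.

Section transport_coupling.
Variables (R : realType) (a b : R) (a1 : 1 <= a) (b1 : 1 <= b).
Local Notation mu := (@lebesgue_measure R).
Local Notation P := (beta_probability a1 b1).
Local Notation F := (rcdf P).
Local Notation T := (transport a1 b1).
Local Notation f := (beta_density a b).

(** The beta law is carried by the open unit interval. *)
Lemma eq_beta_probability (A B : set (measurableTypeR R)) :
  measurable A -> measurable B -> (forall u, 0 < u < 1 -> A u <-> B u) ->
  P A = P B.
Proof.
move=> mA mB AB.
have E (C : set (measurableTypeR R)) : measurable C ->
    P C = (\int[mu]_(u in `]0%R, 1%R[) ((\1_C u)%:E * (f u)%:E))%E.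
  move=> mC; rewrite -(integral_beta_probability a1 b1 (g := fun u => (\1_C u)%:E)).
  - by rewrite integral_indic// setIT.
  - exact/measurable_EFinP/measurable_indic.
  - by move=> x; rewrite lee_fin.
rewrite !E//; apply: eq_integral => u; rewrite inE/= in_itv/= => u01.
have ABu := AB u u01; rewrite !indicE.
by congr ((_%:R)%:E * _)%E; apply: (congr1 nat_of_bool); apply/idP/idP; rewrite !inE => /ABu.
Qed.

(** The extension by 0 makes the map measurable on the whole line. *)
Definition coupled_normal : measurableTypeR R -> R := T \_ `]0, 1[.

Lemma coupled_normalE u : 0 < u < 1 -> coupled_normal u = T u.
Proof. by move=> u01; rewrite /coupled_normal patchE mem_set//= in_itv. Qed.

Lemma measurable_coupled_normal : measurable_fun setT coupled_normal.
Proof.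
have mI : @measurable _ (measurableTypeR R) `]0, 1[ by exact: measurable_itv.
apply: (measurable_restrictT _ mI).1; apply: measurable_fun_oo => u.
exact: continuous_transport.
Qed.

Lemma beta_cdf_surj y : 0 < y < 1 -> exists2 u, 0 < u < 1 & F u = y.
Proof.
move=> y01; have [x xy] := gauss_cdf_surj y01.
have [d /andP[d0 d1] Hd] := transport_lt_near0 a1 b1 x.
have [e /andP[e0 e1] He] := transport_gt_near1 a1 b1 x.
pose v := Num.min (d / 2) (1 / 2); pose w := Num.max ((e + 1) / 2) (1 / 2).
have v0 : 0 < v by rewrite lt_min; apply/andP; split; lra.
have vd : v <= d / 2 by rewrite ge_min lexx.
have v2 : v <= 1 / 2 by rewrite ge_min lexx orbT.
have w1 : w < 1 by rewrite gt_max; apply/andP; split; lra.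
have ew : (e + 1) / 2 <= w by rewrite le_max lexx.
have w2 : 1 / 2 <= w by rewrite le_max lexx orbT.
have vw : v <= w by lra.
have v01 : 0 < v < 1 by lra.
have w01 : 0 < w < 1 by lra.
have Fv : F v <= y.
  rewrite -(gauss_cdf_transport a1 b1 v01) -xy gauss_cdf_le_mono ltW// Hd//; lra.
have Fw : y <= F w.
  rewrite -(gauss_cdf_transport a1 b1 w01) -xy gauss_cdf_le_mono ltW// He//; lra.
have [||u] := @IVT R F v w y vw.
- apply: continuous_in_subspaceT => u; rewrite inE/= in_itv/= => uvw.
  have u01 : 0 < u < 1 by lra.
  have [du _] := is_derive_beta_cdf a1 b1 u01.
  exact/differentiable_continuous/derivable1_diffP.
- by rewrite ge_min Fv/= le_max Fw orbT.
- by rewrite in_itv/= => uvw <-; exists u => //; lra.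
Qed.

(** If [F u = gauss_cdf x], then [T v <= x] and [v <= u] both say that
    [F v <= F u]. *)
Lemma has_law_coupled_normal : has_law P coupled_normal (normal_prob 0 1).
Proof.
have mX : @measurable_fun _ _ (measurableTypeR R) (measurableTypeR R) setT
  coupled_normal by exact: measurable_coupled_normal.
pose X : {mfun measurableTypeR R >-> measurableTypeR R} :=
  HB.pack coupled_normal (isMeasurableFun.Build _ _ _ _ _ mX).
pose Q : probability (measurableTypeR R) R := distribution P X.
have mI (i : interval R) : @measurable _ (measurableTypeR R) [set` i].
  exact: measurable_itv.
move=> A mA; apply: (@probability_eq_rcdf R Q (normal_prob 0 1)) => // x.
rewrite -/(gauss_cdf x); have x01 := gauss_cdf_itv x.
have [u u01 Fu] := beta_cdf_surj x01.
rewrite -Fu /rcdf; congr fine.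
apply: eq_beta_probability.
- rewrite -[X in measurable X]setTI; exact: (mX measurableT _ (mI _)).
- exact: mI.
move=> v v01; rewrite /= !in_itv/= coupled_normalE//.
rewrite -gauss_cdf_le_mono gauss_cdf_transport// -Fu.
have [uv|vu] := ltP u v; last by split => // _; exact: le_rcdf.
by split => //; rewrite leNgt beta_cdf_lt//; lra.
Qed.

Lemma has_sqrt_beta_law_sqrt :
  has_sqrt_beta_law P (Num.sqrt : measurableTypeR R -> R) a b.
Proof.
split; first by apply: aeW => u; exact: sqrtr_ge0.
move=> A mA; rewrite -[RHS]/(P A); apply: eq_beta_probability => //.
- rewrite -[X in measurable X]setTI.
  have mS : @measurable_fun _ _ (measurableTypeR R) R setT (fun t => Num.sqrt t ^+ 2).
    by apply: measurable_funX; exact: measurable_sqrt.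
  exact: (mS measurableT _ mA).
- by move=> u /andP[u0 _] /=; rewrite sqr_sqrtr// ltW.
Qed.

Lemma integral_coupling_error (c m : R) :
  (\int[P]_u ((Num.sqrt u - m - c * coupled_normal u) ^+ 2)%:E =
   \int[mu]_(u in `]0%R, 1%R[) (f u * (c * T u - (Num.sqrt u - m)) ^+ 2)%:E)%E.
Proof.
rewrite integral_beta_probability.
- apply: eq_integral => u; rewrite inE/= in_itv/= => u01.
  by rewrite coupled_normalE// -EFinM; congr EFin; ring.
- apply/measurable_EFinP; apply: measurable_funX; apply: measurable_funB.
    by apply: measurable_funB => //; exact: measurable_sqrt.
  by apply: measurable_funM => //; exact: measurable_coupled_normal.
- by move=> u; rewrite lee_fin sqr_ge0.
Qed.

End transport_coupling.

(** * Error estimates for the coupling *)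

Section coupling_estimates.
Variables (R : realType) (a b : R) (a1 : 1 <= a) (b1 : 1 <= b).
Local Notation mu := (@lebesgue_measure R).
Local Notation P := (beta_probability a1 b1).
Local Notation T := (transport a1 b1).
Local Notation X := (coupled_normal a1 b1).
Local Notation f := (beta_density a b).

(** [(y - c * t) ^ 2 <= 2 * y ^ 2 + 2 * c ^ 2 * t ^ 2], where [y <= 1] and
    [t = T u] has second moment 1. *)
Lemma integral_coupling_error_trivial (c : R) :
  (\int[P]_u ((Num.sqrt u - 0 - c * X u) ^+ 2)%:E <= (2 + 2 * c ^+ 2)%:E)%E.
Proof.
rewrite integral_coupling_error.
have mf : measurable_fun (`]0, 1[ : set (measurableTypeR R)) (EFin \o f).
  by apply/measurable_EFinP; apply: measurable_fun_oo; exact: continuous_beta_density.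
have mT : measurable_fun (`]0, 1[ : set (measurableTypeR R))
    (fun u => (f u * T u ^+ 2)%:E).
  apply/measurable_EFinP; apply: measurable_fun_oo => u u01.
  apply: cvgM; first exact: continuous_beta_density.
  by apply: cvgr_exprn; exact: continuous_transport.
have itv01 : @measurable _ (measurableTypeR R) `]0, 1[ by exact: measurable_itv.
have f0 u : `]0%R, 1%R[%classic u -> (0 <= (f u)%:E)%E.
  by move=> _; rewrite lee_fin beta_density_ge0.
have T0 u : `]0%R, 1%R[%classic u -> (0 <= (f u * T u ^+ 2)%:E)%E.
  by move=> _; rewrite lee_fin mulr_ge0 ?sqr_ge0 ?beta_density_ge0.
have c2 : 0 <= 2 * c ^+ 2 by rewrite mulr_ge0 ?sqr_ge0.
apply: (@le_trans _ _ (\int[mu]_(u in `]0%R, 1%R[)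
   (2%:E * (f u)%:E + (2 * c ^+ 2)%:E * (f u * T u ^+ 2)%:E))%E).
  apply: ge0_le_integral => //.
  - by move=> u _; rewrite lee_fin mulr_ge0 ?sqr_ge0 ?beta_density_ge0.
  - apply/measurable_EFinP; apply: measurable_fun_oo => u u01.
    apply: cvgM; first exact: continuous_beta_density.
    apply: cvgr_exprn; apply: cvgB.
      by apply: cvgM; [exact: cvg_cst|exact: continuous_transport].
    by apply: cvgB; [exact: sqrt_continuous|exact: cvg_cst].
  - by apply: emeasurable_funD; exact: measurable_funeM.
  - move=> u; rewrite /= in_itv/= => /andP[u0 u1].
    rewrite -!EFinM -EFinD lee_fin.
    rewrite (_ : 2 * f u + _ = f u * (2 + 2 * c ^+ 2 * T u ^+ 2)); last ring.
    rewrite ler_wpM2l ?beta_density_ge0//.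
    have := sqr_sqrtr (ltW u0); have := sqr_ge0 (c * T u + Num.sqrt u).
    by rewrite subr0 !expr2; nra.
rewrite ge0_integralD//; last 4 first.
- by move=> u u01; rewrite mule_ge0 ?f0.
- exact: measurable_funeM.
- by move=> u u01; rewrite mule_ge0 ?T0.
- exact: measurable_funeM.
rewrite (ge0_integralZl mu itv01 mf f0)// (ge0_integralZl mu itv01 mT T0)//.
by rewrite integral_beta_density// integral_transport_sqr !mule1.
Qed.

(** With [y = Num.sqrt u], the defect times [y * (1 - u)] is [p + q]. The
    choice of [m] and [c] matches the minimum and the curvature there of the
    leading part of the negative logarithm of the density, so that [p] has a
    double zero at [y = m]; the rest [q] is of order [1 / N]. *)
Lemma score_defect_le (N m u : R) : 0 < N -> 0 < m < 1 -> a = N * m ^+ 2 ->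
  b = N * (1 - m ^+ 2) -> 0 < u < 1 ->
  score_defect a b (Num.sqrt b / (2 * N)) m u ^+ 2 * (u * (1 - u) ^+ 2) <=
  8 / (m ^+ 2) ^+ 2 * (u - m ^+ 2) ^+ 4 + 1 / (2 * N ^+ 2).
Proof.
move=> N0 /andP[m0 m1] aE bE /andP[u0 u1].
have y0 : 0 < 1 - u by rewrite subr_gt0.
have yp : 0 < Num.sqrt u by rewrite sqrtr_gt0.
have uE : u = Num.sqrt u ^+ 2 by rewrite sqr_sqrtr// ltW.
have b0 : 0 <= b by apply: le_trans b1.
have c2 : (Num.sqrt b / (2 * N)) ^+ 2 = b / (4 * N ^+ 2).
  by rewrite exprMn sqr_sqrtr// exprVn exprMn; congr (_ / (_ * _)); ring.
have yl1 : Num.sqrt u <= 1 by rewrite -[leRHS]sqrtr1 ler_sqrt// ltW.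
rewrite /score_defect c2; move: yp uE yl1; set y := Num.sqrt u => yp uE yl1.
pose p := (y - m) ^+ 2 * (2 * y ^+ 2 + 2 * m * y - 1 + m ^+ 2) / 2.
pose q := (1 - m ^+ 2) * (1 - 3 * u) / (4 * N).
rewrite (_ : _ * _ = (p + q) ^+ 2); last first.
  rewrite [in LHS]aE [in LHS]bE /p /q uE; rewrite uE in y0.
  by field; rewrite !gt_eqF.
have pl : `|p| <= 2 * ((u - m ^+ 2) ^+ 2 / m ^+ 2).
  rewrite /p normrM normrM (ger0_norm (sqr_ge0 _)) [X in _ * X <= _]gtr0_norm; last by rewrite invr_gt0.
  apply: (@le_trans _ _ (2 * (y - m) ^+ 2)).
    rewrite -[leLHS]mulrA [leRHS]mulrC ler_wpM2l ?sqr_ge0//.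
    rewrite ler_pdivrMr// ler_norml; apply/andP; split; nra.
  rewrite ler_wpM2l// ler_pdivlMr ?exprn_gt0// uE subr_sqr exprMn.
  rewrite ler_wpM2l ?sqr_ge0// ler_pXn2r// ?nnegrE ?addr_ge0 ?ltW//.
  by rewrite ltrDr.
have ql : `|q| <= 1 / (2 * N).
  rewrite /q normrM [X in _ * X <= _]gtr0_norm; last by rewrite invr_gt0 mulr_gt0.
  rewrite ler_pdivrMr ?mulr_gt0//.
  rewrite (_ : 1 / (2 * N) * (4 * N) = 2); last by field; rewrite gt_eqF.
  have m2 : 0 <= 1 - m ^+ 2 <= 1.
    by rewrite subr_ge0 exprn_ile1 ?(ltW m0) ?(ltW m1)//= lerBlDr lerDl sqr_ge0.
  by rewrite ler_norml; apply/andP; split; nra.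
apply: (@le_trans _ _ (2 * p ^+ 2 + 2 * q ^+ 2)).
  by have := sqr_ge0 (p - q); rewrite !expr2; nra.
apply: lerD.
  have -> : 8 / (m ^+ 2) ^+ 2 * (u - m ^+ 2) ^+ 4 =
      2 * (2 * ((u - m ^+ 2) ^+ 2 / m ^+ 2)) ^+ 2.
    by field; rewrite gt_eqF.
  rewrite ler_wpM2l// -[leLHS]ger0_norm ?sqr_ge0// normrX ler_pXn2r// ?nnegrE//.
  by rewrite mulr_ge0// divr_ge0// sqr_ge0.
have -> : 1 / (2 * N ^+ 2) = 2 * (1 / (2 * N)) ^+ 2 by field; rewrite gt_eqF.
rewrite ler_wpM2l// -[leLHS]ger0_norm ?sqr_ge0// normrX ler_pXn2r// ?nnegrE//.
by rewrite divr_ge0// mulr_ge0// ltW.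
Qed.

(** The transport inequality reduces the error to the mean of the squared score
    defect, whose singularities turn the exponents [a] and [b] of the weight
    into [a - 1] and [b - 2]. *)
Lemma integral_coupling_error_le (N m2 : R) : 16 <= a -> 16 <= b ->
  N = a + b -> m2 = a / N ->
  (\int[P]_u ((Num.sqrt u - Num.sqrt m2 -
       Num.sqrt b / (2 * N) * X u) ^+ 2)%:E
   <= (520 / (m2 ^+ 3 * (1 - m2) ^+ 2 * N ^+ 2))%:E)%E.
Proof.
move=> a16 b16 NE m2E.
have N0 : 0 < N by rewrite NE; lra.
have m01 : 0 < m2 < 1.
  by rewrite m2E divr_gt0/= ?ltr_pdivrMr ?mul1r ?NE//; lra.
have /andP[m0 m1] := m01.
have sm : Num.sqrt m2 ^+ 2 = m2 by rewrite sqr_sqrtr// ltW.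
have sm01 : 0 < Num.sqrt m2 < 1.
  by rewrite sqrtr_gt0 m0/= -[ltRHS]sqrtr1 ltr_sqrt.
have B0 := beta_integral_gt0 a1 b1.
set c := Num.sqrt b / (2 * N).
have c0 : 0 < c by rewrite divr_gt0 ?sqrtr_gt0 ?mulr_gt0//; lra.
rewrite integral_coupling_error.
apply: le_trans (@transport_score_estimate R a b c (Num.sqrt m2) a1 b1 _ _ c0 _) _;
  [lra|lra|by have /andP[/ltW -> /ltW ->] := sm01|].
have m0' : 0 <= (beta_integral a b)^-1 by rewrite invr_ge0 ltW.
pose g x := 8 / m2 ^+ 2 * (x - m2) ^+ 4 + 1 / (2 * N ^+ 2).
have cg x : {for x, continuous g}.
  by rewrite /g; solve_continuous.
have mg : measurable_fun (`]0, 1[ : set (measurableTypeR R))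
    (fun x => (g x * beta_weight (a - 1) (b - 2) x)%:E).
  by apply/measurable_EFinP; apply: measurable_fun_oo; exact: continuous_mul_beta_weight.
have g0 x : 0 <= g x.
  apply: addr_ge0; last by rewrite divr_ge0// mulr_ge0// sqr_ge0.
  by rewrite mulr_ge0 ?exprn_even_ge0// divr_ge0// sqr_ge0.
apply: (@le_trans _ _ (\int[mu]_(x in `]0%R, 1%R[) ((beta_integral a b)^-1%:E *
    (g x * beta_weight (a - 1) (b - 2) x)%:E))%E).
  apply: ge0_le_integral => //.
  - by move=> u _; rewrite lee_fin mulr_ge0 ?sqr_ge0 ?beta_density_ge0.
  - apply/measurable_EFinP; apply: measurable_fun_oo => u u01.
    apply: cvgM; first exact: continuous_beta_density.
    by apply: cvgr_exprn; exact: continuous_score_defect.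
  - exact: measurable_funeM.
  - move=> u; rewrite /= in_itv/= => u01; rewrite -EFinM lee_fin.
    have w0 := beta_weight_gt0 (a - 1) (b - 2) u01.
    rewrite /beta_density.
    have -> : beta_weight a b u = (u * (1 - u) ^+ 2) * beta_weight (a - 1) (b - 2) u.
      rewrite -[in LHS](subrK 1 a) -[in LHS](subrK 2 b) (_ : b - 2 + 2 = b - 2 + 1 + 1); last ring.
      by rewrite beta_weightSl// !beta_weightSr//; ring.
    rewrite mulrAC [leRHS]mulrC ler_wpM2r// mulrAC ler_wpM2r ?(ltW w0)//.
    rewrite mulrC; have := @score_defect_le N (Num.sqrt m2) u N0 sm01.
    rewrite sm; apply => //.
      by rewrite m2E mulrC divfK// gt_eqF.
    by rewrite m2E mulrBr mulr1 mulrC divfK ?gt_eqF// NE; ring.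
rewrite ge0_integralZl//; last first.
  move=> u; rewrite /= in_itv/= => u01.
  by rewrite lee_fin mulr_ge0// ltW// beta_weight_gt0.
rewrite lee_pdivrMl// -EFinM mulrC; exact: beta_int_defect_le.
Qed.

End coupling_estimates.

(** The mean square distance to a constant is least at the expectation. *)
Lemma variance_le_sqr_dist (d : measure_display) (T : measurableType d)
    (R : realType) (P : probability T R) (Z : T -> R) (m K : R) :
  measurable_fun setT Z ->
  (\int[P]_t ((Z t - m) ^+ 2)%:E <= K%:E)%E -> ('V_P[Z] <= K%:E)%E.
Proof.
move=> mZ ZK; pose W : T -> R := Z \- cst m.
have mW : measurable_fun setT W by exact: measurable_funB.
have W2 : W \in Lfun P 2%:E.
  rewrite inE; apply/andP; split; rewrite inE//=.
  rewrite /finite_norm unlock /Lnorm; apply: poweR_lty.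
  apply: (@le_lt_trans _ _ K%:E); last exact: ltry.
  apply: le_trans ZK; rewrite le_eqVlt; apply/orP; left; apply/eqP.
  by apply: eq_integral => t _; rewrite /= powR_mulrn// -normrX ger0_norm ?sqr_ge0.
have ZE : Z = W \+ cst m by apply/funext => t; rewrite /W /= subrK.
rewrite ZE varianceD_cst_r// varianceE//.
apply: (@le_trans _ _ ('E_P[W ^+ 2])%E).
  by rewrite geeDl// oppe_le0 sqre_ge0.
apply: le_trans ZK; rewrite unlock le_eqVlt; apply/orP; left; apply/eqP.
by apply: eq_integral.
Qed.

(** * From mean square distance to distribution functions *)

(** If [U <= x] then [V <= x + e] unless [`|U - V|] exceeds [e], which is
    improbable by Chebyshev's inequality. *)
Lemma le_cdf_perturb (d : measure_display) (T : measurableType d)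
    (R : realType) (P : probability T R) (U V : T -> R) (K x e : R) :
  measurable_fun setT U -> measurable_fun setT V -> 0 < e ->
  (\int[P]_t ((U t - V t) ^+ 2)%:E <= K%:E)%E ->
  (P (U @^-1` `]-oo, x]%classic) <=
     P (V @^-1` `]-oo, (x + e)%R]%classic) + (K / e ^+ 2)%:E)%E.
Proof.
move=> mU mV e0 UVK.
pose A := [set t | e ^+ 2 <= (U t - V t) ^+ 2].
have mUV : measurable_fun setT (fun t => (U t - V t) ^+ 2).
  by apply: measurable_funX; exact: measurable_funB.
have mA : measurable A.
  rewrite (_ : A = (fun t => (U t - V t) ^+ 2) @^-1` `[e ^+ 2, +oo[).
    by rewrite -[X in measurable X]setTI; exact: mUV.
  by apply/seteqP; split => t /=; rewrite in_itv/= andbT.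
have mpre (W : T -> R) y : measurable_fun setT W ->
    measurable (W @^-1` `]-oo, y]%classic).
  by move=> mW; rewrite -[X in measurable X]setTI; exact: mW.
have PA : (P A <= (K / e ^+ 2)%:E)%E.
  rewrite mulrC EFinM -lee_pdivrMl ?invr_gt0 ?exprn_gt0// invrK.
  apply: le_trans UVK.
  have -> : ((e ^+ 2)%:E * P A = \int[P]_t ((e ^+ 2)%:E * (\1_A t)%:E))%E.
    rewrite ge0_integralZl//; last 2 first.
    - exact/measurable_EFinP/measurable_indic.
    - by rewrite lee_fin sqr_ge0.
    by rewrite integral_indic// setIT.
  apply: ge0_le_integral => //.
  - by move=> t _; rewrite mule_ge0// lee_fin sqr_ge0.
  - by apply/measurable_funeM/measurable_EFinP/measurable_indic.
  - exact/measurable_EFinP.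
  - move=> t _; rewrite -EFinM lee_fin indicE.
    have [tA|tA] := boolP (t \in A); last by rewrite mulr0 sqr_ge0.
    by rewrite mulr1; move: tA; rewrite inE.
apply: (@le_trans _ _ (P (V @^-1` `]-oo, (x + e)%R]%classic `|` A))).
  apply: le_measure; rewrite ?inE; [exact: mpre| |].
    by apply: measurableU => //; exact: mpre.
  move=> t /=; rewrite !in_itv/= => Ux.
  have [Vx|Vx] := leP (V t) (x + e); [by left|right].
  rewrite /A/= -[leRHS]sqrrN ler_pXn2r// ?nnegrE; lra.
apply: le_trans (measureU2 _ _ _) _ => //; first exact: mpre.
exact: leeD.
Qed.

(** As [Y] is almost surely nonnegative, its law is determined by that of its
    square, on whatever probability space it lives. *)
Lemma sqrt_beta_law_cdf (d : measure_display) (T : measurableType d)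
    (R : realType) (P : probability T R) (Y : T -> R) (r s t : R) :
  measurable_fun setT Y -> has_sqrt_beta_law P Y r s ->
  P (Y @^-1` `]-oo, t]%classic) =
    if 0 <= t then beta_law r s `]-oo, (t ^+ 2)%R]%classic else 0%E.
Proof.
move=> mY [Y0 lawY].
have mpre (W : T -> R) (i : interval R) : measurable_fun setT W ->
    measurable (W @^-1` [set` i]).
  move=> mW; rewrite -[X in measurable X]setTI; apply: mW => //.
have mY2 : measurable_fun setT (fun t => Y t ^+ 2) by exact: measurable_funX.
have PN : P (Y @^-1` `]-oo, 0%R[%classic) = 0%E.
  apply: measure_negligible; first exact: mpre.
  move: Y0 => [N [mN N0 sN]]; exists N; split => //.
  apply: subset_trans sN => u /=; rewrite in_itv/= => Yu.
  by apply/negP; rewrite -ltNge.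
have [t0|t0] := leP 0 t; last first.
  apply: (subset_measure0 _ _ _ PN); [exact: mpre|exact: mpre|].
  by move=> u /=; rewrite !in_itv/= => /le_lt_trans; apply.
rewrite -lawY; last exact: measurable_itv.
rewrite /pushforward; apply/eqP; rewrite eq_le; apply/andP; split.
  rewrite -[leRHS]adde0 -PN; apply: le_trans _ (measureU2 _ _ _); last 2 first.
  - exact: mpre.
  - exact: mpre.
  apply: le_measure; rewrite ?inE; [exact: mpre| |].
    by apply: measurableU; exact: mpre.
  move=> u /=; rewrite !in_itv/= => Yt.
  have [Yu|Yu] := leP 0 (Y u); [left|by right].
  by rewrite ler_pXn2r// ?nnegrE.
apply: le_measure; rewrite ?inE; [exact: mpre|exact: mpre|].
move=> u /=; rewrite !in_itv/= => Yt.
rewrite (le_trans (ler_norm _))// -(ler_pXn2r (ltn0Sn 1)) ?nnegrE//.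
by rewrite -normrX ger0_norm ?sqr_ge0.
Qed.

(** After division by [c] the coupled variables are at mean square distance at
    most [520 / (m2 ^ 3 * (1 - m2) ^ 2 * N ^ 2 * c ^ 2)]; since
    [c ^ 2 = b / (4 * N ^ 2)], this is where [2080 = 4 * 520] comes from. *)
Lemma sqrt_beta_cdf_close (R : realType) (a b N m2 x e : R)
    (a1 : 1 <= a) (b1 : 1 <= b) : 16 <= a -> 16 <= b ->
  N = a + b -> m2 = a / N -> 0 < e ->
  gauss_cdf (x - e) - 2080 / (m2 ^+ 3 * (1 - m2) ^+ 2 * b * e ^+ 2) <=
  fine (beta_probability a1 b1
     (Num.sqrt @^-1` `]-oo, (Num.sqrt m2 + Num.sqrt b / (2 * N) * x)%R]%classic))
  <= gauss_cdf (x + e) + 2080 / (m2 ^+ 3 * (1 - m2) ^+ 2 * b * e ^+ 2).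
Proof.
move=> a16 b16 NE m2E e0.
set C := 2080 / _; set t := Num.sqrt m2 + _; set r := fine _.
have N0 : 0 < N by rewrite NE; lra.
have b0 : 0 < b by lra.
have m01 : 0 < m2 < 1.
  by rewrite m2E divr_gt0/= ?ltr_pdivrMr ?mul1r ?NE//; lra.
have /andP[m0 m1] := m01.
set P := beta_probability a1 b1 in r *.
set c := Num.sqrt b / (2 * N) in t r *.
have c0 : 0 < c by rewrite divr_gt0 ?sqrtr_gt0 ?mulr_gt0.
have c2 : c ^+ 2 = b / (4 * N ^+ 2).
  by rewrite exprMn sqr_sqrtr ?(ltW b0)// exprVn exprMn; congr (_ / (_ * _)); ring.
pose V u : R := (Num.sqrt u - Num.sqrt m2) / c.
pose X := coupled_normal a1 b1.
have mX : measurable_fun setT X := measurable_coupled_normal a1 b1.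
have mV : @measurable_fun _ _ (measurableTypeR R) R setT V.
  apply: measurable_funM => //; apply: measurable_funB => //.
  exact: measurable_sqrt.
have VX : (\int[P]_u ((V u - X u) ^+ 2)%:E <= (C * e ^+ 2)%:E)%E.
  have -> : (\int[P]_u ((V u - X u) ^+ 2)%:E = \int[P]_u ((c ^+ 2)^-1%:E *
      ((Num.sqrt u - Num.sqrt m2 - c * X u) ^+ 2)%:E))%E.
    apply: eq_integral => u _; rewrite -EFinM; congr EFin.
    by rewrite /V; field; rewrite gt_eqF.
  rewrite ge0_integralZl//; last 3 first.
  - apply/measurable_EFinP; apply: measurable_funX; apply: measurable_funB.
      by apply: measurable_funB => //; exact: measurable_sqrt.
    exact: measurable_funM.
  - by move=> u _; rewrite lee_fin sqr_ge0.
  - by rewrite lee_fin invr_ge0 sqr_ge0.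
  rewrite lee_pdivrMl ?exprn_gt0// -EFinM.
  rewrite (_ : c ^+ 2 * _ = 520 / (m2 ^+ 3 * (1 - m2) ^+ 2 * N ^+ 2)).
    exact: integral_coupling_error_le.
  rewrite c2 /C; field.
  by rewrite !gt_eqF// subr_gt0.
have XV : (\int[P]_u ((X u - V u) ^+ 2)%:E <= (C * e ^+ 2)%:E)%E.
  by under eq_integral do rewrite -sqrrN opprB.
have lawX y : P (X @^-1` `]-oo, y]%classic) = (gauss_cdf y)%:E.
  rewrite /gauss_cdf EFin_rcdf; apply: (has_law_coupled_normal a1 b1).
  exact: measurable_itv.
have preV : Num.sqrt @^-1` `]-oo, t]%classic = V @^-1` `]-oo, x]%classic.
  apply/seteqP; split => u /=; rewrite !in_itv/= /V /t ler_pdivrMr// (mulrC x).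
    by rewrite lerBlDl.
  by rewrite lerBlDl.
have rE : r%:E = P (V @^-1` `]-oo, x]%classic).
  rewrite /r preV fineK// fin_num_measure//.
  by rewrite -[X in measurable X]setTI; apply: mV => //; exact: measurable_itv.
have Ce : C * e ^+ 2 / e ^+ 2 = C by rewrite mulfK// gt_eqF// exprn_gt0.
apply/andP; split.
  rewrite lerBlDr -lee_fin EFinD rE -lawX.
  by have := le_cdf_perturb (x - e) mX mV e0 XV; rewrite subrK Ce.
by rewrite -lee_fin EFinD rE -lawX; have := le_cdf_perturb x mV mX e0 VX; rewrite Ce.
Qed.

(** * Asymptotic normality and the coupling bound *)

Section main_constants.
Variable R : realType.
Implicit Types p q : R.

Lemma sqrt_beta_scale p q (n : nat) : 0 < p -> 0 < q -> (0 < n)%N ->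
  Num.sqrt (n%:R * q) / (2 * (n%:R * p + n%:R * q)) =
  Num.sqrt q / (2 * (p + q) * Num.sqrt n%:R).
Proof.
move=> p0 q0 n0; have n0' : (0 : R) < n%:R by rewrite ltr0n.
have s0 : 0 < Num.sqrt (n%:R : R) by rewrite sqrtr_gt0.
have nE : (n%:R : R) = Num.sqrt n%:R ^+ 2 by rewrite sqr_sqrtr// ltW.
rewrite sqrtrM ?(ltW n0')// -mulrDr [in X in _ = X]mulrC.
move: s0 nE; set y := Num.sqrt (n%:R : R); move=> s0 nE.
rewrite nE; field.
by rewrite !gt_eqF// addr_gt0.
Qed.

Lemma beta_mean_ratio p q (n : nat) : 0 < p -> 0 < q -> (0 < n)%N ->
  p / (p + q) = n%:R * p / (n%:R * p + n%:R * q).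
Proof.
move=> p0 q0 n0; have n0' : (0 : R) < n%:R by rewrite ltr0n.
by rewrite -mulrDr; field; rewrite !gt_eqF// addr_gt0.
Qed.

(** The first term is [n ^ 2 * (520 / (m2 ^ 3 * (1 - m2) ^ 2 * N ^ 2))] for
    [m2 = p / (p + q)] and [N = n * (p + q)]. The second one covers the [n] for
    which [n * p] or [n * q] is less than 16: then [n] is less than
    [16 * (1 / p + 1 / q)] and the variance is at most [3 = 768 / 16 ^ 2]. *)
Definition coupling_constant p q : R :=
  520 * (p + q) ^+ 3 / (p ^+ 3 * q ^+ 2) + 768 * ((p + q) / (p * q)) ^+ 2.

Lemma coupling_constant_gt0 p q : 0 < p -> 0 < q -> 0 < coupling_constant p q.
Proof.
move=> p0 q0; have pq : 0 < p + q by rewrite addr_gt0.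
apply: addr_gt0.
  apply: divr_gt0; last by rewrite mulr_gt0// exprn_gt0.
  by apply: mulr_gt0; [rewrite ltr0n|exact: exprn_gt0].
apply: mulr_gt0; first by rewrite ltr0n.
by apply: exprn_gt0; apply: divr_gt0 => //; exact: mulr_gt0.
Qed.

Lemma continuous_coupling_constant :
  {within [set pq : R * R | 0 < pq.1 /\ 0 < pq.2],
     continuous (fun pq : R * R => coupling_constant pq.1 pq.2)}.
Proof.
apply: continuous_in_subspaceT => -[p q]; rewrite inE/= => -[p0 q0].
have c1 : (fun pq : R * R => pq.1) @ (p, q) --> p by exact: cvg_fst.
have c2 : (fun pq : R * R => pq.2) @ (p, q) --> q by exact: cvg_snd.
have cs := cvgD c1 c2.
rewrite /prop_for /continuous_at /coupling_constant /=.
apply: cvgD.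
- apply: cvgM; first by apply: cvgM; [exact: cvg_cst|apply: cvgr_exprn; exact: cs].
  apply: cvgV; first by rewrite gt_eqF// mulr_gt0// exprn_gt0.
  by apply: cvgM; apply: cvgr_exprn; [exact: c1|exact: c2].
- apply: cvgM; first exact: cvg_cst.
  apply: cvgr_exprn; apply: cvgM; first exact: cs.
  by apply: cvgV; [rewrite gt_eqF// mulr_gt0|exact: (cvgM c1 c2)].
Qed.

End main_constants.

(** The distribution function of [Y n] is that of the coupled variable, which
    is within mean square distance [O (1 / n)] of a standard normal variable
    after standardization. *)
Lemma sqrt_beta_clt (R : realType) (p q : R) (d : nat -> measure_display)
    (T : forall n, measurableType (d n)) (P : forall n, probability (T n) R)
    (Y : forall n, {RV (P n) >-> R}) : 0 < p -> 0 < q ->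
  (forall n : nat, (0 < n)%N ->
     has_sqrt_beta_law (P n) (Y n) (n%:R * p) (n%:R * q)) ->
  cvg_in_distribution P
    (fun (n : nat) (t : T n) =>
       2 * (p + q) / Num.sqrt q * Num.sqrt n%:R
         * (Y n t - Num.sqrt (p / (p + q))))
    (normal_prob 0 1).
Proof.
move=> p0 q0 lawY x _.
pose Z (n : nat) (t : T n) : R := 2 * (p + q) / Num.sqrt q * Num.sqrt n%:R
  * (Y n t - Num.sqrt (p / (p + q))).
change ((fun n => pushforward (P n) (Z n) `]-oo, x]%classic) @ \oo --> normal_prob 0 1 `]-oo, x]%classic).
have pq0 : 0 < p + q by rewrite addr_gt0.
pose m2 := p / (p + q).
have m20 : 0 < m2 by rewrite divr_gt0.
have m21 : 0 < 1 - m2.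
  by rewrite subr_gt0 ltr_pdivrMr// mul1r ltrDl.
pose C e : R := 2080 / (m2 ^+ 3 * (1 - m2) ^+ 2 * q * e ^+ 2).
have close n e : 0 < e -> 16 / p <= n%:R -> 16 / q <= n%:R ->
  pushforward (P n) (Z n) `]-oo, x]%classic \is a fin_num /\
  gauss_cdf (x - e) - C e / n%:R <=
    fine (pushforward (P n) (Z n) `]-oo, x]%classic) <=
  gauss_cdf (x + e) + C e / n%:R.
  move=> e0; rewrite !ler_pdivrMr// => np nq.
  have n0 : (0 < n)%N.
    by rewrite lt0n; apply/eqP => n0; move: np; rewrite n0 mul0r; lra.
  have n0' : (0 : R) < n%:R by rewrite ltr0n.
  have a1 : 1 <= n%:R * p by lra.
  have b1 : 1 <= n%:R * q by lra.
  have E : pushforward (P n) (Z n) `]-oo, x]%classic =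
      beta_probability a1 b1 (Num.sqrt @^-1`
        `]-oo, (Num.sqrt m2 + Num.sqrt (n%:R * q) / (2 * (n%:R * p + n%:R * q)) * x)%R]%classic).
    rewrite (sqrt_beta_law_cdf _ (@measurable_sqrt R) (has_sqrt_beta_law_sqrt a1 b1)).
    rewrite -(sqrt_beta_law_cdf _ _ (lawY n n0))//.
    rewrite /pushforward; congr (P n _).
    have k0 : 0 < 2 * (p + q) / Num.sqrt q * Num.sqrt n%:R.
      by rewrite mulr_gt0 ?divr_gt0 ?mulr_gt0 ?sqrtr_gt0.
    have kE : Num.sqrt q / (2 * (p + q) * Num.sqrt n%:R) =
        (2 * (p + q) / Num.sqrt q * Num.sqrt n%:R)^-1.
      by field; rewrite !gt_eqF ?sqrtr_gt0.
    rewrite sqrt_beta_scale// kE.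
    by apply/seteqP; split => t /=; rewrite !in_itv/= -lerBlDl ler_pdivlMl.
  rewrite E; split.
    rewrite fin_num_measure// -[X in measurable X]setTI.
    by apply: (@measurable_sqrt R) => //; exact: measurable_itv.
  have := sqrt_beta_cdf_close x a1 b1 np nq erefl (beta_mean_ratio p0 q0 n0) e0.
  rewrite -/m2 (_ : 2080 / _ = C e / n%:R)//.
  by rewrite /C; field; rewrite !gt_eqF.
rewrite -EFin_rcdf -/(gauss_cdf x).
apply/fine_cvgP; split.
  near=> n; have [] := close n 1 ltr01 _ _ => //; near: n; exact: nbhs_infty_ger.
apply/cvgrPdist_le => e e0.
have e2 : 0 < e / 2 by rewrite divr_gt0.
have /cvgrPdist_lt/(_ _ e2)[dl /= dl0 Hdl] := @continuous_gauss_cdf R x.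
pose h := dl / 2.
have h0 : 0 < h by rewrite divr_gt0.
have near_x y : `|x - y| <= h -> `|gauss_cdf x - gauss_cdf y| < e / 2.
  by move=> xy; apply: Hdl; rewrite /ball_/= (le_lt_trans xy)// /h; lra.
near=> n.
have n1 : 16 / p <= n%:R by near: n; exact: nbhs_infty_ger.
have n2 : 16 / q <= n%:R by near: n; exact: nbhs_infty_ger.
have n3 : 2 * C h / e <= n%:R by near: n; exact: nbhs_infty_ger.
have n0' : (0 : R) < n%:R by apply: lt_le_trans n1; rewrite divr_gt0.
have [_ /andP[l1 l2]] := close n h h0 n1 n2.
have C2 : C h / n%:R <= e / 2.
  by move: n3; rewrite ler_pdivrMr// ler_pdivrMr// => n3; lra.
have k1 : `|gauss_cdf x - gauss_cdf (x - h)| < e / 2.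
  by apply: near_x; rewrite opprB addrC subrK ger0_norm// ltW.
have k2 : `|gauss_cdf x - gauss_cdf (x + h)| < e / 2.
  by apply: near_x; rewrite opprD addrA subrr add0r normrN ger0_norm// ltW.
move: k1 k2 l1 l2; rewrite /= !ltr_norml ler_norml.
move=> /andP[? ?] /andP[? ?] ? ?; apply/andP; split; lra.
Unshelve. all: by end_near. Qed.

Lemma sqrt_beta_coupling (R : realType) (p q : R) (n : nat) :
  0 < p -> 0 < q -> Num.max p^-1 q^-1 < n%:R ->
  exists (d : measure_display) (T : measurableType d)
    (P : probability T R) (X Y : {RV P >-> R}),
    [/\ has_law P X (normal_prob 0 1),
        has_sqrt_beta_law P Y (n%:R * p) (n%:R * q)
      & ('V_P[(fun t : T => (Y t
           - Num.sqrt q / (2 * (p + q) * Num.sqrt n%:R) * X t)%R)]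
         <= (coupling_constant p q / n%:R ^+ 2)%:E)%E].
Proof.
move=> p0 q0; rewrite gt_max => /andP[np nq].
have n0' : (0 : R) < n%:R by apply: lt_trans np; rewrite invr_gt0.
have n0 : (0 < n)%N by rewrite -(ltr0n R).
have a1' : 1 < n%:R * p by rewrite -ltr_pdivrMr// div1r.
have b1' : 1 < n%:R * q by rewrite -ltr_pdivrMr// div1r.
have a1 := ltW a1'; have b1 := ltW b1'.
pose P := beta_probability a1 b1.
pose X : {RV P >-> R} := HB.pack (coupled_normal a1 b1)
  (isMeasurableFun.Build _ _ _ _ _ (measurable_coupled_normal a1 b1)).
pose Y : {RV P >-> R} := HB.pack (Num.sqrt : measurableTypeR R -> R)
  (isMeasurableFun.Build _ _ _ _ _ (@measurable_sqrt R)).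
exists _, (measurableTypeR R), P, X, Y; split.
- exact: has_law_coupled_normal.
- exact: has_sqrt_beta_law_sqrt.
rewrite -(sqrt_beta_scale p0 q0 n0).
set c := Num.sqrt _ / _; set Z : measurableTypeR R -> R := (fun t => _).
have mZ : measurable_fun setT Z.
  apply: measurable_funB; first exact: measurable_sqrt.
  by apply: measurable_funM => //; exact: measurable_coupled_normal.
have pq0 : 0 < p + q by rewrite addr_gt0.
have n2 : (0 : R) < n%:R ^+ 2 by rewrite exprn_gt0.
have [/andP[a16 b16]|small] := boolP ((16 <= n%:R * p) && (16 <= n%:R * q)).
- apply: (@variance_le_sqr_dist _ _ _ _ _ (Num.sqrt (p / (p + q)))) => //.
  have := integral_coupling_error_le a1 b1 a16 b16 erefl (beta_mean_ratio p0 q0 n0).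
  under eq_integral do rewrite addrAC.
  move=> /le_trans; apply; rewrite lee_fin /coupling_constant [leRHS]mulrDl.
  set w := (p + q) / (p * q); set k := 520 / _.
  rewrite (_ : k = 520 * (p + q) ^+ 3 / (p ^+ 3 * q ^+ 2) / n%:R ^+ 2); last first.
    by rewrite /k; field; rewrite !gt_eqF// addr_gt0 ?mulr_gt0.
  rewrite lerDl; apply: divr_ge0; last exact: ltW.
  by apply: mulr_ge0; [rewrite ler0n|exact: sqr_ge0].
apply: (@variance_le_sqr_dist _ _ _ _ _ 0) => //.
have := integral_coupling_error_trivial a1 b1 c.
under eq_integral do rewrite addrAC.
move=> /le_trans; apply; rewrite lee_fin.
have c2 : c ^+ 2 <= 1 / 2.
  rewrite /c exprMn sqr_sqrtr; last by rewrite mulr_ge0 ?(ltW n0') ?(ltW q0).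
  move: a1' b1'; set a := n%:R * p; set b := n%:R * q => a1' b1'.
  have ab : 0 < 2 * (a + b) by lra.
  by rewrite exprVn ler_pdivrMr ?exprn_gt0// expr2; nra.
have w0 : 0 < (p + q) / (p * q) by rewrite divr_gt0// mulr_gt0.
have nw : n%:R <= 16 * ((p + q) / (p * q)).
  have -> : (p + q) / (p * q) = p^-1 + q^-1 by field; rewrite !gt_eqF.
  have [ip iq] : 0 < p^-1 /\ 0 < q^-1 by rewrite !invr_gt0.
  move: small; rewrite negb_and -!ltNge -!ltr_pdivlMr//.
  by case/orP => h; rewrite (le_trans (ltW h))// ler_wpM2l// ?lerDl ?lerDr ltW.
(* [n <= 16 * (1 / p + 1 / q)], so the second term of the constant suffices *)
have small' : 3 <= 768 * ((p + q) / (p * q)) ^+ 2 / n%:R ^+ 2.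
  rewrite ler_pdivlMr//.
  have : (n%:R : R) ^+ 2 <= (16 * ((p + q) / (p * q))) ^+ 2.
    have w16 : 0 <= 16 * ((p + q) / (p * q)) by rewrite mulr_ge0// ltW.
    by rewrite ler_pXn2r// nnegrE// ltW.
  move: ((p + q) / (p * q)) => w; rewrite exprMn => h.
  have -> : 768 * w ^+ 2 = 3 * (16 ^+ 2 * w ^+ 2) by ring.
  by rewrite ler_wpM2l.
apply: (@le_trans _ _ 3); first by move: c2; set c' := c ^+ 2; lra.
apply: (le_trans small'); rewrite /coupling_constant [leRHS]mulrDl lerDr.
apply: divr_ge0; last exact: ltW.
apply: divr_ge0; last by rewrite mulr_ge0 ?exprn_ge0 ?(ltW p0) ?(ltW q0).
by apply: mulr_ge0; [rewrite ler0n|rewrite exprn_ge0 ?(ltW pq0)].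
Qed.

Theorem lemmaC1 (R : realType) :
  (forall (p q : R), 0 < p -> 0 < q ->
   forall (d : nat -> measure_display) (T : forall n, measurableType (d n))
     (P : forall n, probability (T n) R) (Y : forall n, {RV (P n) >-> R}),
     (forall n : nat, (0 < n)%N ->
        has_sqrt_beta_law (P n) (Y n) (n%:R * p) (n%:R * q)) ->
     cvg_in_distribution P
       (fun (n : nat) (t : T n) =>
          2 * (p + q) / Num.sqrt q * Num.sqrt n%:R
            * (Y n t - Num.sqrt (p / (p + q))))
       (normal_prob 0 1))
  /\
  (exists K : R -> R -> R,
    [/\ (forall p q : R, 0 < p -> 0 < q -> 0 < K p q),
        {within [set pq : R * R | 0 < pq.1 /\ 0 < pq.2],
           continuous (fun pq : R * R => K pq.1 pq.2)}
      & forall (p q : R) (n : nat), 0 < p -> 0 < q ->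
          Num.max p^-1 q^-1 < n%:R ->
          exists (d : measure_display) (T : measurableType d)
            (P : probability T R) (X Y : {RV P >-> R}),
            [/\ has_law P X (normal_prob 0 1),
                has_sqrt_beta_law P Y (n%:R * p) (n%:R * q)
              & ('V_P[(fun t : T => (Y t
                   - Num.sqrt q / (2 * (p + q) * Num.sqrt n%:R) * X t)%R)]
                 <= (K p q / n%:R ^+ 2)%:E)%E]]).
Proof.
split; first by move=> p q p0 q0 d T P Y; exact: sqrt_beta_clt.
exists (@coupling_constant R); split.
- exact: coupling_constant_gt0.
- exact: continuous_coupling_constant.
- exact: sqrt_beta_coupling.
Qed.
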